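(* Let $g\in M(I)$, let $\mathcal{G}=\mathcal{G}_g$ be the ultragraph induced by $g$, let $x\in E_g$, and let $J$ be the unique index with $g^{\tau(x)}(x)\in E_J$. Let $X\subseteq\mathcal{G}^0$. If for all $v_i\in X$ we have $\mathring{I_i}\cap g^{-1}(E_J)=\emptyset$, then the map $\nu_x:C^*(\mathcal{G},X)\to B(\ell^2(R_g(x)))$ determined by $\nu_x(p_B)=W_B$ for $B\in\mathcal{E}$ and $\nu_x(s_{e_i})=T_{e_i}$ for $i\in\mathbb{N}$ is a $*$-homomorphism.
   Context: $\mathbb{N}=\{1,2,\dots\}$. Let $I=[a,b)$ with $a\in\mathbb{R}$, $b\in\mathbb{R}\cup\{\infty\}$. A map $g$ belongs to the Markov class $M(I)$ if: (1) there are closed intervals $(I_n)_{n\in\mathbb{N}}$ with $\max(I_j)\le\min(I_{j+1})$, $|I_i\cap I_j|\le1$ for $i\neq j$, $\mathrm{dom}(g)=\bigcup_nI_n\subseteq I$, $\min(I_1)=a$ and $\sup(I_n)\to b$; (2) $g|_{\mathring{I_i}}$ is injective for each $i$ ($\mathring{I_i}$ is the interior), $\mathrm{Im}(g)\subseteq I$ and $g(\Gamma)\subseteq\Gamma$, where $\Gamma=\bigcup_n\partial I_n$; (3) for every $i$, $g(I_i)\cap\bigcup_nI_n$ is a nonempty union of intervals of the form $I_n$. Let $g_i=g|_{I_i}$ and let the escape sets be $E_n=(\max I_n,\min I_{n+1})$ (possibly empty), so $I=\bigcup_nI_n\cup\bigcup_nE_n$. The ultragraph $\mathcal{G}_g$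 has vertices $\{v_i:i\in\mathbb{N}\}$, edges $\{e_i:i\in\mathbb{N}\}$, source $s(e_i)=v_i$ and range the set $r(e_i)=\{v_j:\mathring{I_j}\subseteq g(\mathring{I_i})\}$. $\mathcal{E}$ is the smallest family of subsets of $\mathcal{G}^0$ containing $\emptyset$, all $\{v_i\}$ and all $r(e_i)$, closed under finite unions and finite intersections. For $X\subseteq\mathcal{G}^0$ (every vertex emits exactly one edge), $C^*(\mathcal{G},X)$ is the universal $C^*$-algebra generated by partial isometries $s_e$ ($e\in\mathcal{G}^1$) with mutually orthogonal ranges and projections $p_A$ ($A\in\mathcal{E}$) with $p_\emptyset=0$, $p_Ap_B=p_{A\cap B}$, $p_{A\cup B}=p_A+p_B-p_{A\cap B}$, $s_e^*s_e=p_{r(e)}$, $s_es_e^*\le p_{\{s(e)\}}$, and $p_{\{v\}}=\sum_{s(e)=v}s_es_e^*$ for every $v\in X$. $E_g=\bigcup_{k\in\mathbb{N}}g^{-k}\bigl(\bigcup_jE_j\bigr)$. For $x\in E_g$ let $\tau(x)\in\mathbb{N}$ be the unique number with $g^{\tau(x)-1}(x)\in\mathrm{dom}(g)$ and $g^{\tau(x)}(x)\notin\mathrm{dom}(g)$ ($g^0(x)=x$), and $R_g(x)=\{y\in\mathrm{dom}(g):g^n(y)=g^{\tau(x)}(x)\text{ for some }n\in\mathbb{N}\}$. $\ell^2(R_g(x))$ has orthonormal basis $\{\delta_y:y\in R_g(x)\}$. Define bounded operators by $W_B(\delta_y)=\chi_{\bigcup_{\{j:v_j\in B\}}I_j}(y)\,\delta_y$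 and $T_{e_i}(\delta_y)=\chi_{\bigcup_{\{j:v_j\in r(e_i)\}}I_j}(y)\,\delta_{g_i^{-1}(y)}$, where, when the characteristic function is nonzero, $g_i^{-1}(y)$ is the unique preimage of $y$ under $g$ in $I_i$ (it lies in $\mathring{I_i}\cap R_g(x)$). *)

(* Defs.v *)
From HB Require Import structures.
Set Warnings "-notation-overridden,-notation-incompatible-prefix,-ambiguous-paths".
From mathcomp Require Import all_boot all_order all_algebra.
From mathcomp Require Import all_classical all_reals all_analysis.
From mathcomp Require Import complex ring lra.

Set Implicit Arguments.
Unset Strict Implicit.
Unset Printing Implicit Defensive.

Import Order.TTheory GRing.Theory Num.Theory.
Import numFieldNormedType.Exports.

Local Open Scope classical_set_scope.
Local Open Scope ring_scope.
Local Open Scope complex_scope.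

(** * C*-algebras *)

(* C*-algebras are not assumed to be unital, so the product cannot be the one
   of a ring structure.  As everywhere for normed modules over R[i], the norm
   takes its values in R[i]. *)
HB.mixin Record CompleteNormedModule_isCStarAlgebra (R : realType) A
    & CompleteNormedModule R[i] A := {
  cmul : A -> A -> A;
  cstar : A -> A;
  cmulA : associative cmul;
  cmulDl : forall x y z, cmul (x + y) z = cmul x z + cmul y z;
  cmulDr : forall x y z, cmul x (y + z) = cmul x y + cmul x z;
  cmulZl : forall (k : R[i]) x y, cmul (k *: x) y = k *: cmul x y;
  cmulZr : forall (k : R[i]) x y, cmul x (k *: y) = k *: cmul x y;
  cstarK : involutive cstar;
  cstarD : forall x y, cstar (x + y) = cstar x + cstar y;
  cstarZ : forall (k : R[i]) x, cstar (k *: x) = k^* *: cstar x;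
  cstarM : forall x y, cstar (cmul x y) = cmul (cstar y) (cstar x);
  norm_cmul : forall x y, `|cmul x y| <= `|x| * `|y|;
  norm_cstar_cmul : forall x, `|cmul (cstar x) x| = `|x| ^+ 2
}.

#[short(type="cstarAlgType")]
HB.structure Definition CStarAlgebra (R : realType) :=
  {A of CompleteNormedModule R[i] A & CompleteNormedModule_isCStarAlgebra R A}.

Reserved Notation "x ^#*" (at level 1, format "x ^#*").
Notation "x ** y" := (cmul x y) (at level 40, left associativity) : ring_scope.
Notation "x ^#*" := (cstar x) : ring_scope.

Section CStarBasics.
Context {R : realType}.

Definition star_hom (A B : cstarAlgType R) (phi : A -> B) : Prop :=
  [/\ forall (k : R[i]) x y, phi (k *: x + y) = k *: phi x + phi y,
      forall x y, phi (x ** y) = phi x ** phi y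
    & forall x, phi (x^#*) = (phi x)^#*].

(* The positive elements of a C*-algebra are those of the form c^* c. *)
Definition cle (A : cstarAlgType R) (x y : A) : Prop :=
  exists c : A, y - x = c^#* ** c.

Definition is_projection (A : cstarAlgType R) (x : A) : Prop :=
  x^#* = x /\ x ** x = x.

Definition is_partial_isometry (A : cstarAlgType R) (x : A) : Prop :=
  x ** x^#* ** x = x.

End CStarBasics.

(** * Ultragraphs and their relative C*-algebras *)

Record ultragraph := Ultragraph {
  vertex : Type;
  edge : choiceType;
  source : edge -> vertex;
  range_of : edge -> set vertex
}.

Inductive gen_vertices (G : ultragraph) : set (vertex G) -> Prop :=
| gen_empty : gen_vertices set0
| gen_vertex v : gen_vertices [set v]
| gen_range e : gen_vertices (range_of e)
| gen_union A B : gen_vertices A -> gen_vertices B -> gen_vertices (A `|` B)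
| gen_inter A B : gen_vertices A -> gen_vertices B -> gen_vertices (A `&` B).

Section UltragraphAlgebra.
Context {R : realType} (G : ultragraph) (X : set (vertex G)).

(* The values of p outside [gen_vertices] are irrelevant. *)
Record ultragraph_family (A : cstarAlgType R)
    (p : set (vertex G) -> A) (s : edge G -> A) : Prop := {
  family_proj : forall V, gen_vertices V -> is_projection (p V);
  family_pisom : forall e, is_partial_isometry (s e);
  family_orth : forall e f, e <> f ->
    (s e ** (s e)^#*) ** (s f ** (s f)^#*) = 0;
  family_set0 : p set0 = 0;
  family_setI : forall V W, gen_vertices V -> gen_vertices W ->
    p V ** p W = p (V `&` W);
  family_setU : forall V W, gen_vertices V -> gen_vertices W ->
    p (V `|` W) = p V + p W - p (V `&` W);
  family_range : forall e, (s e)^#* ** s e = p (range_of e);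
  family_source : forall e, cle (s e ** (s e)^#*) (p [set source e]);
  family_CK : forall v, X v ->
    p [set v] = \sum_(e \in [set e | source e = v]) (s e ** (s e)^#*)
}.

(* (A, p, s) is C*(G, X), characterized (up to isomorphism) by its universal
   property; that A is generated by p and s is a consequence of uniqueness. *)
Definition is_ultragraph_algebra (A : cstarAlgType R)
    (p : set (vertex G) -> A) (s : edge G -> A) : Prop :=
  ultragraph_family p s /\
  forall (B : cstarAlgType R) (q : set (vertex G) -> B) (t : edge G -> B),
    ultragraph_family q t ->
    exists! phi : A -> B,
      [/\ star_hom phi,
          forall V, gen_vertices V -> phi (p V) = q V
        & forall e, phi (s e) = t e].

End UltragraphAlgebra.

(** * The Hilbert space l^2(S) and its bounded operators *)

Section SquareSummable.
Context {R : realType} (S : choiceType).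

Definition sqsum (f : S -> R[i]) : \bar R :=
  \esum_(s in [set: S]) (Normc.normc (f s) ^+ 2)%:E.

Definition l2_pred : {pred S -> R[i]} := fun f => `[< (sqsum f < +oo)%E >].

Lemma l2_submod_closed : submod_closed l2_pred.
Proof.
have normc_ge0 (z : R[i]) : 0 <= Normc.normc z by case: z => u v; exact: sqrtr_ge0.
split=> [|k f h /asboolP fl /asboolP hl]; apply/asboolP.
  rewrite /sqsum esum1 ?ltry// => s _.
  by rewrite (_ : (0 : S -> R[i]) s = 0)// Normc.normc0 expr0n.
pose c := 2 * Normc.normc k ^+ 2.
have c0 : 0 <= c by rewrite mulr_ge0 ?sqr_ge0.
have sqsumZ (r : R) (u : S -> R[i]) : 0 <= r -> (sqsum u < +oo)%E ->
    (\esum_(s in [set: S]) (r * Normc.normc (u s) ^+ 2)%:E < +oo)%E.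
  move=> r0 ul; apply: (@le_lt_trans _ _ (r%:E * sqsum u)%E).
    apply: ge_ereal_sup => _ [F FS <-].
    rewrite (eq_fsbigr (fun s => r%:E * (Normc.normc (u s) ^+ 2)%:E)%E); last first.
      by move=> s _; rewrite EFinM.
    rewrite -ge0_mule_fsumr; last by move=> s; rewrite lee_fin sqr_ge0.
    apply: lee_pmul => //; first by rewrite fsume_ge0// => s _; rewrite lee_fin sqr_ge0.
    by apply: ereal_sup_ubound; exists F.
  by rewrite lte_mul_pinfty ?lee_fin ?esum_ge0// => s _; rewrite lee_fin sqr_ge0.
apply: (@le_lt_trans _ _
    (\esum_(s in [set: S]) ((c * Normc.normc (f s) ^+ 2)%:E
                         + (2 * Normc.normc (h s) ^+ 2)%:E))%E).
  apply: le_esum => s _; rewrite -EFinD lee_fin.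
  have -> : (k *: f + h) s = k * f s + h s by [].
  apply: (@le_trans _ _ ((Normc.normc k * Normc.normc (f s)
                          + Normc.normc (h s)) ^+ 2)).
    by rewrite ler_pXn2r ?nnegrE ?addr_ge0 ?mulr_ge0// -Normc.normcM le_normcD.
  rewrite /c -mulrA -exprMn.
  move: (Normc.normc k * _) (Normc.normc (h s)) => u v.
  rewrite -subr_ge0 (_ : _ - _ = (u - v) ^+ 2) ?sqr_ge0//.
  by ring.
rewrite esumD; last 2 first.
- by move=> s _; rewrite lee_fin mulr_ge0 ?sqr_ge0.
- by move=> s _; rewrite lee_fin mulr_ge0 ?sqr_ge0.
by rewrite lte_add_pinfty// sqsumZ.
Qed.

HB.instance Definition _ := GRing.isSubmodClosed.Build R[i] (S -> R[i]) l2_pred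
  l2_submod_closed.

Record l2 := L2 { l2_val :> S -> R[i]; l2P : l2_val \in l2_pred }.

HB.instance Definition _ := [isSub for l2_val].
HB.instance Definition _ := gen_eqMixin l2.
HB.instance Definition _ := gen_choiceMixin l2.
HB.instance Definition _ := [SubChoice_isSubLmodule of l2 by <:].

Definition l2norm (f : l2) : R := Num.sqrt (fine (sqsum f)).

(* Unordered sum of an absolutely summable family of real numbers. *)
Definition rsum (u : S -> R) : R :=
  fine (\esum_(s in [set: S]) (Num.max (u s) 0)%:E)
  - fine (\esum_(s in [set: S]) (Num.max (- u s) 0)%:E).

Definition csum (u : S -> R[i]) : R[i] :=
  rsum (fun s => complex.Re (u s)) +i* rsum (fun s => complex.Im (u s)).

Definition inner (f h : l2) : R[i] := csum (fun s => f s * (h s)^* ).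

Lemma delta_l2 (y : S) : (fun s : S => (s == y)%:R : R[i]) \in l2_pred.
Proof.
apply/asboolP; rewrite /sqsum (esumID [set y]); last first.
  by move=> s _; rewrite lee_fin sqr_ge0.
rewrite setTI esum_set1 ?lee_fin ?sqr_ge0// setTI esum1 ?adde0 ?ltry// => s /= /eqP.
by move=> /negPf ->; rewrite Normc.normc0 expr0n.
Qed.

Definition delta (y : S) : l2 := L2 (delta_l2 y).

Record bop := Bop {
  bop_fun :> l2 -> l2;
  bop_linear : forall (k : R[i]) f h, bop_fun (k *: f + h) = k *: bop_fun f + bop_fun h;
  bop_bounded : exists M : R, forall f, l2norm (bop_fun f) <= M * l2norm f
}.

(* A *-homomorphism from A to B(l^2(S)): the *-algebra operations of B(l^2(S))
   are the pointwise linear structure, composition, and the adjoint with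
   respect to the inner product. *)
Definition bop_star_hom (A : cstarAlgType R) (nu : A -> bop) : Prop :=
  [/\ forall (k : R[i]) x y f, nu (k *: x + y) f = k *: nu x f + nu y f,
      forall x y f, nu (x ** y) f = nu x (nu y f)
    & forall x f h, inner (nu x f) h = inner f (nu (x^#*) h)].

End SquareSummable.

(** * Markov maps with escape sets *)

(* The intervals I_n = [lo n, hi n] are indexed from 0, whereas exponents of g
   range over {1, 2, ...} (whence the conditions 0 < n below).  A partial map
   is a function to [option R]. *)
Section Markov.
Context {R : realType}.
Variables (a : R) (b : \bar R) (g : R -> option R) (lo hi : nat -> R).

Definition ambient : set R := [set x | a <= x /\ (x%:E < b)%E].
Definition mI (n : nat) : set R := `[lo n, hi n].
Definition mIo (n : nat) : set R := `]lo n, hi n[.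
Definition escape_set (n : nat) : set R := `]hi n, lo n.+1[.
Definition endpoints : set R := [set x | exists n, x = lo n \/ x = hi n].
Definition mdom : set R := \bigcup_n mI n.

Definition pimage (A : set R) : set R :=
  [set y | exists2 x, A x & g x = Some y].

(* [piter n x = Some y] iff g^n(x) is defined and equal to y. *)
Definition piter (n : nat) (x : R) : option R := iter n (obind g) (Some x).

Definition ppreimage (n : nat) (A : set R) : set R :=
  [set x | exists2 y, A y & piter n x = Some y].

Record markov_class : Prop := {
  markov_le : forall n, lo n <= hi n;
  markov_order : forall n, hi n <= lo n.+1;
  markov_meet : forall i j, i <> j -> is_subset1 (mI i `&` mI j);
  markov_dom : [set x | g x <> None] = mdom;
  markov_dom_sub : mdom `<=` ambient;
  markov_min : lo 0%N = a;
  markov_sup : (fun n => (hi n)%:E) @ \oo --> b;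
  markov_inj : forall i x y, mIo i x -> mIo i y -> g x = g y -> x = y;
  markov_im : pimage mdom `<=` ambient;
  markov_endpoints : pimage endpoints `<=` endpoints;
  markov_union : forall i, exists2 K : set nat, K !=set0 &
    pimage (mI i) `&` mdom = \bigcup_(n in K) mI n
}.

Definition markov_ultragraph : ultragraph :=
  {| vertex := nat; edge := nat; source := id;
     range_of := fun i => [set j | mIo j `<=` pimage (mIo i)] |}.

Definition escaping : set R :=
  \bigcup_(k in [set k | (0 < k)%N]) ppreimage k (\bigcup_j escape_set j).

Definition escape_time (x : R) (tau : nat) : Prop :=
  (0 < tau)%N /\ exists y z, [/\ piter tau.-1 x = Some y, mdom y,
                                 piter tau x = Some z & ~ mdom z].

Definition escape_orbit (x : R) (tau : nat) : set R :=
  [set y | mdom y /\ exists2 n, (0 < n)%N & piter n y = piter tau x].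

Definition vset (B : set nat) : set R := \bigcup_(j in B) mI j.

Section Operators.
Variables (x : R) (tau : nat).
Local Notation S := (set_type (escape_orbit x tau)).

Definition is_W (B : set nat) (W : @bop R S) : Prop :=
  forall y : S, (vset B (val y) -> W (delta y) = delta y) /\
                (~ vset B (val y) -> W (delta y) = 0).

Definition is_T (i : nat) (T : @bop R S) : Prop :=
  forall y : S,
    (vset (@range_of markov_ultragraph i) (val y) ->
      exists z : S, [/\ mIo i (val z), g (val z) = Some (val y),
        forall w, mI i w -> g w = Some (val y) -> w = val z
        & T (delta y) = delta z]) /\
    (~ vset (@range_of markov_ultragraph i) (val y) -> T (delta y) = 0).

End Operators.
End Markov.

(* Main.v *)
Require Import Defs.
From HB Require Import structures.
From mathcomp Require Import all_boot all_order all_algebra.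
From mathcomp Require Import all_classical all_reals all_analysis.
From mathcomp Require Import complex ring lra.

(** A representation of C*(G, X) is the same thing as a family of operators that
    satisfies the defining relations, provided that the operators live in a C*-algebra;
    so the proof has two halves.

    The first half makes the operators on the Hilbert space of square summable
    families into a C*-algebra. Its elements are the bounded maps that have an adjoint
    for the inner product ([adjop]). The inner product satisfies the Cauchy-Schwarz
    inequality ([cauchy_schwarz]) and the space is complete ([l2_complete]); the
    operators are then complete for the operator norm ([adjop_complete]), and the
    C*-identity is [opnorm_adjoint_comp].

    The second half checks the relations. The edge and vertex operators come from
    partial bijections of the escape orbit ([transfer]): the branch of g on the i-th
    open interval ([branch]) for the edge i, and the identity of the union of the
    intervals indexed by B for a set B of vertices ([restr], [vdom]). For a partial
    bijection, T T^* and T^* T are the projections onto its domain and its codomain, so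
    each relation becomes an equality or inclusion between subsets of the orbit. No
    point of the orbit is an endpoint of an interval ([orbitNendpoint]), because
    endpoints never leave the domain; so every point has a unique interval, the
    projections multiply as they should ([vdomI]), and different branches have
    disjoint domains. The codomain of the i-th branch consists of the orbit
    points in the range of the edge i ([pdom_inv_branch]). Its domain consists of the
    orbit points in the i-th interval that are not sent out of the domain of g. A point
    sent out lands in the escape set J, so for a vertex in X the domain contains every
    orbit point of the interval ([pdom_branch]), which is the Cuntz-Krieger relation.

    The universal property then gives the homomorphism. It is unique among all maps
    into bounded operators because a star-homomorphism provides the adjoints of its own
    values ([lift_star_hom]). *)

Set Implicit Arguments.
Unset Strict Implicit.
Unset Printing Implicit Defensive.

Import Order.TTheory GRing.Theory Num.Theory.
Import numFieldNormedType.Exports.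

Local Open Scope classical_set_scope.
Local Open Scope ring_scope.

(** * Unordered sums of real and complex families *)

Section Sums.
Context {R : realType} {S : choiceType}.
Implicit Types (u v p q : S -> R) (k : R) (w z : S -> R[i]).

Definition summableR u : Prop := (\esum_(s in [set: S]) `|u s|%:E < +oo)%E.

Lemma summableR_le u v : (forall s, `|u s| <= v s) -> summableR v -> summableR u.
Proof.
move=> uv; apply: le_lt_trans; apply: le_esum => s _.
by rewrite lee_fin (le_trans (uv s))// ler_norm.
Qed.

Lemma summableRD u v : summableR u -> summableR v ->
  summableR (fun s => u s + v s).
Proof.
rewrite /summableR => us vs.
have : (\esum_(s in [set: S]) (`|u s|%:E + `|v s|%:E) < +oo)%E.
  by rewrite esumD ?lte_add_pinfty// => s _; rewrite lee_fin.
apply: le_lt_trans; apply: le_esum => s _.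
by rewrite -EFinD lee_fin ler_normD.
Qed.

(** The inequality from left to right also holds for the inverse scalar, which gives
    the other one. *)
Lemma esumZ_ge0 k u : 0 <= k -> (forall s, 0 <= u s) ->
  (\esum_(s in [set: S]) (k * u s)%:E = k%:E * \esum_(s in [set: S]) (u s)%:E)%E.
Proof.
have le_esumZ r v : 0 <= r -> (forall s, 0 <= v s) ->
  (\esum_(s in [set: S]) (r * v s)%:E <= r%:E * \esum_(s in [set: S]) (v s)%:E)%E.
  move=> r0 v0; apply: ge_ereal_sup => _ [F FS <-].
  rewrite (eq_fsbigr (fun s => r%:E * (v s)%:E)%E); last by move=> s _; rewrite EFinM.
  rewrite -ge0_mule_fsumr; last by move=> s; rewrite lee_fin.
  apply: lee_pmul => //; first by rewrite fsume_ge0// => s _; rewrite lee_fin.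
  by apply: ereal_sup_ubound; exists F.
move=> k0 u0; apply/eqP; rewrite eq_le le_esumZ//=.
have [->|kn0] := eqVneq k 0.
  by rewrite mul0e esum_ge0// => s _; rewrite mul0r.
have kp : 0 < k by rewrite lt_def kn0.
rewrite muleC -lee_pdivlMr// muleC.
have := @le_esumZ k^-1 (fun s => k * u s).
rewrite (eq_esum (b := fun s => (u s)%:E)); last first.
  by move=> s _; rewrite mulKf.
by apply; rewrite ?invr_ge0// => s; rewrite mulr_ge0.
Qed.

Lemma summableRZ k u : summableR u -> summableR (fun s => k * u s).
Proof.
rewrite /summableR => us.
rewrite (eq_esum (b := fun s => (`|k| * `|u s|)%:E)); last first.
  by move=> s _; rewrite normrM.
rewrite esumZ_ge0// lte_mul_pinfty ?lee_fin//.
Qed.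

Lemma summableRN u : summableR u -> summableR (fun s => - u s).
Proof.
by rewrite /summableR; under [X in _ -> (X < _)%E]eq_esum do rewrite normrN.
Qed.

Lemma summableR_esum_fin u : (forall s, 0 <= u s) -> summableR u ->
  (\esum_(s in [set: S]) (u s)%:E \is a fin_num)%E.
Proof.
move=> u0 us; rewrite ge0_fin_numE; last by apply: esum_ge0 => s _; rewrite lee_fin.
by apply: le_lt_trans us; apply: le_esum => s _; rewrite lee_fin ler_norm.
Qed.

Let pos u : S -> R := fun s => Num.max (u s) 0.
Let neg u : S -> R := fun s => Num.max (- u s) 0.

Let rsumE u : rsum u = fine (\esum_(s in [set: S]) (pos u s)%:E)
  - fine (\esum_(s in [set: S]) (neg u s)%:E).
Proof. by []. Qed.

Let pos_ge0 u s : 0 <= pos u s. Proof. by rewrite le_max lexx orbT. Qed.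
Let neg_ge0 u s : 0 <= neg u s. Proof. by rewrite le_max lexx orbT. Qed.

Let posB_neg u s : u s = pos u s - neg u s.
Proof.
rewrite /pos /neg; case: (lerP (u s) 0) => h.
  by rewrite max_l ?oppr_ge0//; lra.
by rewrite max_r ?oppr_le0 ?ltW//; lra.
Qed.

Let summable_norm u : summableR u -> summableR (fun s => `|u s|).
Proof. by rewrite /summableR; under [X in _ -> (X < _)%E]eq_esum do rewrite normr_id. Qed.

Let summable_pos u : summableR u -> summableR (pos u).
Proof.
move=> /summable_norm; apply: summableR_le => s.
by rewrite ger0_norm// ge_max ler_norm normr_ge0.
Qed.

Let summable_neg u : summableR u -> summableR (neg u).
Proof.
move=> /summable_norm; apply: summableR_le => s.
by rewrite ger0_norm// ge_max normr_ge0 -normrN ler_norm.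
Qed.

(** [rsum u] is built from the positive and negative parts of [u]. Any other way of
    writing [u] as a difference of nonnegative summable families gives the same
    value, and this freedom is what makes [rsum] additive. *)
Lemma rsumB p q : (forall s, 0 <= p s) -> (forall s, 0 <= q s) ->
  summableR p -> summableR q ->
  rsum (fun s => p s - q s) =
  fine (\esum_(s in [set: S]) (p s)%:E) - fine (\esum_(s in [set: S]) (q s)%:E).
Proof.
move=> p0 q0 ps qs.
pose u := fun s => p s - q s.
have us : summableR u by apply: summableRD => //; exact: summableRN.
rewrite (rsumE u).
have poss := summable_pos us; have negs := summable_neg us.
apply/eqP; rewrite subr_eq addrAC eq_sym subr_eq; apply/eqP.
rewrite -!fineD ?summableR_esum_fin//; congr fine.
rewrite -!esumD; do ?[by move=> s _; rewrite lee_fin].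
apply: eq_esum => s _; rewrite -!EFinD; congr EFin.
by have e : p s - q s = pos u s - neg u s := posB_neg u s; rewrite -[p s](subrK (q s)) e; ring.
Qed.

Lemma rsum_ge0E u : (forall s, 0 <= u s) ->
  rsum u = fine (\esum_(s in [set: S]) (u s)%:E).
Proof.
move=> u0; rewrite /rsum [X in _ - fine X]esum1 ?subr0.
  by congr fine; apply: eq_esum => s _; rewrite max_l.
by move=> s _; rewrite max_r ?oppr_le0.
Qed.

Lemma rsumD u v : summableR u -> summableR v ->
  rsum (fun s => u s + v s) = rsum u + rsum v.
Proof.
move=> us vs.
have -> : (fun s => u s + v s) =
    (fun s => (pos u s + pos v s) - (neg u s + neg v s)).
  by apply/funext => s; rewrite [in LHS](posB_neg u) [in LHS](posB_neg v); ring.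
have up := summable_pos us; have un := summable_neg us.
have vp := summable_pos vs; have vn := summable_neg vs.
rewrite rsumB; do ?[exact: summableRD|by move=> s; rewrite addr_ge0].
have esD p q : (forall s, 0 <= p s) -> (forall s, 0 <= q s) ->
    summableR p -> summableR q ->
    fine (\esum_(s in [set: S]) (p s + q s)%:E) =
    fine (\esum_(s in [set: S]) (p s)%:E) + fine (\esum_(s in [set: S]) (q s)%:E).
  move=> p0 q0 ps qs; rewrite -fineD ?summableR_esum_fin// -esumD//.
  - by move=> s _; rewrite lee_fin.
  - by move=> s _; rewrite lee_fin.
rewrite (esD _ _ (pos_ge0 u) (pos_ge0 v) up vp) (esD _ _ (neg_ge0 u) (neg_ge0 v) un vn).
by rewrite !rsumE opprD addrACA.
Qed.

Lemma rsumN u : rsum (fun s => - u s) = - rsum u.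
Proof.
rewrite /rsum opprB; congr (_ - fine _).
by apply: eq_esum => s _; rewrite opprK.
Qed.

Lemma rsumZ k u : summableR u -> rsum (fun s => k * u s) = k * rsum u.
Proof.
wlog k0 : k / 0 <= k => [wl us|us].
  case: (lerP 0 k) => [k0|/ltW k0]; first exact: wl.
  rewrite -[k]opprK (_ : (fun s => - - k * u s) = (fun s => - (- k * u s))).
    by rewrite rsumN wl ?oppr_ge0// -mulNr.
  by apply/funext => s; rewrite mulNr.
have -> : (fun s => k * u s) = (fun s => k * pos u s - k * neg u s).
  by apply/funext => s; rewrite [in LHS](posB_neg u) mulrBr.
rewrite rsumB; last 4 first.
- by move=> s; rewrite mulr_ge0.
- by move=> s; rewrite mulr_ge0.
- exact/summableRZ/summable_pos.
- exact/summableRZ/summable_neg.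
rewrite !esumZ_ge0//.
have fp := summableR_esum_fin (pos_ge0 u) (summable_pos us).
have fn := summableR_esum_fin (neg_ge0 u) (summable_neg us).
by rewrite !fineM// -mulrBr.
Qed.

Lemma normc_sqrE (c : R[i]) :
  Normc.normc c ^+ 2 = complex.Re c ^+ 2 + complex.Im c ^+ 2.
Proof. by case: c => x y /=; rewrite sqr_sqrtr// addr_ge0 ?sqr_ge0. Qed.

Lemma normc_ge0 (c : R[i]) : 0 <= Normc.normc c.
Proof. by case: c => x y; exact: sqrtr_ge0. Qed.

Lemma normRe_le_normc (c : R[i]) : `|complex.Re c| <= Normc.normc c.
Proof.
by rewrite -(@ler_pXn2r _ 2) ?nnegrE ?normc_ge0// real_normK ?num_real//
  normc_sqrE lerDl sqr_ge0.
Qed.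

Lemma normIm_le_normc (c : R[i]) : `|complex.Im c| <= Normc.normc c.
Proof.
by rewrite -(@ler_pXn2r _ 2) ?nnegrE ?normc_ge0// real_normK ?num_real//
  normc_sqrE lerDr sqr_ge0.
Qed.

Definition summableC w : Prop := summableR (fun s => Normc.normc (w s)).

Let sRe w : summableC w -> summableR (fun s => complex.Re (w s)).
Proof. by apply: summableR_le => s; exact: normRe_le_normc. Qed.

Let sIm w : summableC w -> summableR (fun s => complex.Im (w s)).
Proof. by apply: summableR_le => s; exact: normIm_le_normc. Qed.

Lemma csumD w z : summableC w -> summableC z ->
  csum (fun s => w s + z s) = csum w + csum z.
Proof.
move=> ws zs; rewrite /csum.
have -> : (fun s => complex.Re (w s + z s)) =
    (fun s => complex.Re (w s) + complex.Re (z s)).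
  by apply/funext => s; case: (w s) (z s) => ? ? [].
have -> : (fun s => complex.Im (w s + z s)) =
    (fun s => complex.Im (w s) + complex.Im (z s)).
  by apply/funext => s; case: (w s) (z s) => ? ? [].
by rewrite (rsumD (sRe ws) (sRe zs)) (rsumD (sIm ws) (sIm zs)).
Qed.

Lemma csumZ (c : R[i]) w : summableC w ->
  csum (fun s => c * w s) = c * csum w.
Proof.
move=> ws; rewrite /csum; case: c => x y.
have -> : (fun s => complex.Re ((x +i* y)%C * w s)) =
    (fun s => x * complex.Re (w s) + - y * complex.Im (w s)).
  by apply/funext => s; case: (w s) => ? ? /=; rewrite mulNr.
have -> : (fun s => complex.Im ((x +i* y)%C * w s)) =
    (fun s => x * complex.Im (w s) + y * complex.Re (w s)).
  by apply/funext => s; case: (w s) => ? ? /=.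
have [re im] := (sRe ws, sIm ws).
rewrite (rsumD (summableRZ _ re) (summableRZ _ im)) (rsumZ _ re) (rsumZ _ im).
rewrite (rsumD (summableRZ _ im) (summableRZ _ re)) (rsumZ _ re) (rsumZ _ im).
by rewrite mulNr.
Qed.

Lemma csum_conj w : csum (fun s => (w s)^*) = (csum w)^*.
Proof.
rewrite /csum /=; congr (_ +i* _)%C; last rewrite -rsumN; congr rsum.
  by apply/funext => s; case: (w s).
by apply/funext => s; case: (w s).
Qed.

End Sums.

(** * The inner product *)

Section Inner.
Context {R : realType} {S : choiceType}.
Local Notation H := (@l2 R S).
Implicit Types (f h e : H) (k : R[i]).

Lemma l2_linE k f h s : (k *: f + h) s = k * f s + h s.
Proof. by []. Qed.

Lemma l2_eq f h : (forall s, f s = h s) -> f = h.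
Proof. by move=> fh; apply: val_inj; apply/funext. Qed.

Lemma sqsum_fin f : (sqsum f \is a fin_num)%E.
Proof.
have /asboolP fl := l2P f; rewrite ge0_fin_numE//.
by apply: esum_ge0 => s _; rewrite lee_fin sqr_ge0.
Qed.

Lemma sqsum_ge0 (u : S -> R[i]) : (0 <= sqsum u)%E.
Proof. by apply: esum_ge0 => s _; rewrite lee_fin sqr_ge0. Qed.

Lemma l2norm_ge0 f : 0 <= l2norm f.
Proof. exact: sqrtr_ge0. Qed.

Lemma sqr_l2norm f : l2norm f ^+ 2 = fine (sqsum f).
Proof. by rewrite sqr_sqrtr// fine_ge0// sqsum_ge0. Qed.

Lemma normcJ k : Normc.normc (k^*) = Normc.normc k.
Proof. by case: k => x y /=; rewrite sqrrN. Qed.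

Lemma normc_real (x : R) : Normc.normc (x%:C%C) = `|x|.
Proof. by rewrite /= expr0n /= addr0 sqrtr_sqr. Qed.

Lemma conjD (x y : R[i]) : (x + y)^* = x^* + y^*.
Proof. exact: rmorphD. Qed.

Lemma conjB (x y : R[i]) : (x - y)^* = x^* - y^*.
Proof. exact: rmorphB. Qed.

Lemma conjM (x y : R[i]) : (x * y)^* = x^* * y^*.
Proof. exact: rmorphM. Qed.

Lemma conj_realC (x : R) : (x%:C%C)^* = x%:C%C.
Proof. exact: conjc_real. Qed.

Lemma realCD (x y : R) : (x + y)%:C%C = x%:C%C + y%:C%C.
Proof. exact: rmorphD. Qed.

Lemma realCB (x y : R) : (x - y)%:C%C = x%:C%C - y%:C%C.
Proof. exact: rmorphB. Qed.

Lemma realCM (x y : R) : (x * y)%:C%C = x%:C%C * y%:C%C.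
Proof. exact: rmorphM. Qed.

Lemma realCV (x : R) : (x^-1)%:C%C = x%:C%C^-1.
Proof. exact: fmorphV. Qed.

Lemma conj_divR k (x : R) : (k / x%:C%C)^* = k^* / x%:C%C.
Proof. by rewrite conjM -realCV conj_realC. Qed.

Lemma mulcJ k : k * k^* = (Normc.normc k ^+ 2)%:C%C.
Proof.
rewrite normc_sqrE; case: k => x y; apply/eqP; rewrite eq_complex /=.
by apply/andP; split; apply/eqP; ring.
Qed.

(** Follows from [2 |z w| <= |z|^2 + |w|^2]; it makes the sum that defines [inner]
    absolutely convergent, hence linear. *)
Lemma summable_inner f h : summableC (fun s => f s * (h s)^*).
Proof.
apply: (@summableR_le _ _ _ (fun s => Normc.normc (f s) ^+ 2 + Normc.normc (h s) ^+ 2)).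
  move=> s; rewrite Normc.normcM normcJ ger0_norm ?mulr_ge0 ?normc_ge0//.
  have := sqr_ge0 (Normc.normc (f s) - Normc.normc (h s)).
  have := mulr_ge0 (normc_ge0 (f s)) (normc_ge0 (h s)).
  move: (Normc.normc _) (Normc.normc _) => u v; nra.
apply: summableRD; rewrite /summableR.
  under eq_esum do rewrite ger0_norm ?sqr_ge0//.
  exact/asboolP/(l2P f).
under eq_esum do rewrite ger0_norm ?sqr_ge0//.
exact/asboolP/(l2P h).
Qed.

Lemma inner_lin k f h e : inner (k *: f + h) e = k * inner f e + inner h e.
Proof.
rewrite /inner -csumZ; last exact: summable_inner.
rewrite -csumD; last 2 first.
- have := summable_inner (k *: f) e; congr (summableC _).
  by apply/funext => s; rewrite mulrA.
- exact: summable_inner.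
by congr csum; apply/funext => s; rewrite l2_linE mulrDl mulrA.
Qed.

Lemma innerC f h : inner h f = (inner f h)^*.
Proof.
rewrite /inner -csum_conj; congr csum; apply/funext => s.
by rewrite conjM conjCK mulrC.
Qed.

Lemma inner0l h : inner 0 h = 0.
Proof.
by have := inner_lin (-1) 0 0 h; rewrite scaler0 addr0 mulN1r addNr.
Qed.

Lemma innerDl f h e : inner (f + h) e = inner f e + inner h e.
Proof. by rewrite -[f]scale1r inner_lin mul1r scale1r. Qed.

Lemma innerZl k f e : inner (k *: f) e = k * inner f e.
Proof. by rewrite -[k *: f]addr0 inner_lin inner0l addr0. Qed.

Lemma innerBl f h e : inner (f - h) e = inner f e - inner h e.
Proof. by rewrite innerDl -scaleN1r innerZl mulN1r. Qed.

Lemma innerDr f h e : inner e (f + h) = inner e f + inner e h.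
Proof. by rewrite innerC innerDl conjD -!innerC. Qed.

Lemma innerZr k f e : inner e (k *: f) = k^* * inner e f.
Proof. by rewrite innerC innerZl conjM -!innerC. Qed.

Lemma innerBr f h e : inner e (f - h) = inner e f - inner e h.
Proof. by rewrite innerC innerBl conjB -!innerC. Qed.

Lemma innerff f : inner f f = (l2norm f ^+ 2)%:C%C.
Proof.
rewrite /inner /csum; congr (_ +i* _)%C.
  rewrite sqr_l2norm rsum_ge0E => [|s]; last by rewrite mulcJ sqr_ge0.
  by congr fine; apply: eq_esum => s _; rewrite mulcJ.
rewrite rsum_ge0E => [|s]; last by rewrite mulcJ.
by rewrite esum1// => s _; rewrite mulcJ.
Qed.

Lemma l2norm0_eq0 f : l2norm f = 0 -> f = 0.
Proof.
move=> f0; apply: l2_eq => s; apply: Normc.eq0_normc; apply/eqP.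
rewrite -sqrf_eq0 eq_le sqr_ge0 andbT.
rewrite -(_ : fine (sqsum f) = 0); last by rewrite -sqr_l2norm f0 expr0n.
rewrite -lee_fin fineK ?sqsum_fin//; apply: esum_ge.
by exists [set s]; [split|rewrite fsbig_set1].
Qed.

Lemma l2norm0 : l2norm (0 : H) = 0.
Proof.
apply/eqP; rewrite -sqrf_eq0; apply/eqP/complexI.
by rewrite -innerff inner0l.
Qed.

Lemma inner_inj f h : (forall e, inner f e = inner h e) -> f = h.
Proof.
move=> fh; apply/eqP; rewrite -subr_eq0; apply/eqP/l2norm0_eq0.
apply/eqP; rewrite -sqrf_eq0; apply/eqP/complexI.
by rewrite -innerff innerBl fh subrr.
Qed.

Lemma l2normZ k f : l2norm (k *: f) = Normc.normc k * l2norm f.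
Proof.
apply/eqP; rewrite -(@eqrXn2 _ 2) ?mulr_ge0 ?l2norm_ge0 ?normc_ge0//.
apply/eqP/complexI; rewrite -innerff innerZl innerZr mulrA mulcJ innerff exprMn.
exact/esym/realCM.
Qed.

Lemma l2normN f : l2norm (- f) = l2norm f.
Proof. rewrite -scaleN1r l2normZ (_ : -1 = (-1)%:C%C) ?normc_real ?normrN1 ?mul1r//.
by rewrite (rmorphN (real_complex R)). Qed.

(** The squared norm of [f] minus its projection on the line spanned by [h] is
    nonnegative. *)
Lemma cauchy_schwarz f h : Normc.normc (inner f h) <= l2norm f * l2norm h.
Proof.
have [/l2norm0_eq0 ->|h0] := eqVneq (l2norm h) 0.
  by rewrite innerC inner0l conjC0 Normc.normc0 mulr_ge0 ?l2norm_ge0.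
have hp : 0 < l2norm h ^+ 2 by rewrite exprn_gt0// lt_def h0 l2norm_ge0.
set c := inner f h; set n := l2norm h ^+ 2 in hp.
(* The projection of f on the line of h is (c / n) h. *)
have : n * (l2norm (f - (c / n%:C%C) *: h)) ^+ 2 =
    n * l2norm f ^+ 2 - Normc.normc c ^+ 2.
  apply: complexI; rewrite realCB (realCM n (_ ^+ 2)) (realCM n (_ ^+ 2)) -mulcJ -!innerff.
  rewrite innerBl !innerBr !innerZl !innerZr (innerC f h) -/c innerff -/n.
  rewrite conj_divR.
  have n0 : n%:C%C != 0 by rewrite (inj_eq (@complexI _) n 0) gt_eqF.
  by field.
move=> e; have : 0 <= n * l2norm f ^+ 2 - Normc.normc c ^+ 2.
  by rewrite -e mulr_ge0 ?sqr_ge0 ?ltW.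
rewrite subr_ge0 => le2; rewrite -(@ler_pXn2r _ 2) ?nnegrE ?mulr_ge0 ?l2norm_ge0 ?normc_ge0//.
by rewrite exprMn mulrC.
Qed.

Lemma l2normD f h : l2norm (f + h) <= l2norm f + l2norm h.
Proof.
rewrite -(@ler_pXn2r _ 2) ?nnegrE ?addr_ge0 ?l2norm_ge0//.
have -> : l2norm (f + h) ^+ 2 =
    l2norm f ^+ 2 + l2norm h ^+ 2 + 2 * complex.Re (inner f h).
  apply: complexI; rewrite -innerff innerDl !innerDr !innerff (innerC f h).
  case: (inner f h) => x y; apply/eqP; rewrite eq_complex /=. apply/andP.
  by split; apply/eqP; ring.
have := le_trans (ler_norm _) (normRe_le_normc (inner f h)).
move=> /le_trans/(_ (cauchy_schwarz f h)); lra.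
Qed.

Lemma l2normB f h : l2norm (f - h) <= l2norm f + l2norm h.
Proof. by rewrite (le_trans (l2normD _ _))// l2normN. Qed.

End Inner.

(** * Completeness of the space of square summable families *)

Section Complete.
Context {R : realType} {S : choiceType}.
Local Notation H := (@l2 R S).
Implicit Types (f h e : H) (u : S -> R[i]).

Lemma fsum_le_sqr_l2norm f (X : set S) : finite_set X ->
  \sum_(s \in X) Normc.normc (f s) ^+ 2 <= l2norm f ^+ 2.
Proof.
move=> finX; rewrite sqr_l2norm -lee_fin fineK ?sqsum_fin// -fsumEFin//.
by apply: ereal_sup_ubound; exists X.
Qed.

Lemma sqsum_le_fsum u (M : R) : (forall X, finite_set X ->
  \sum_(s \in X) Normc.normc (u s) ^+ 2 <= M) -> (sqsum u <= M%:E)%E.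
Proof.
move=> uM; apply: ge_ereal_sup => _ [X [finX _] <-].
by rewrite fsumEFin// lee_fin uM.
Qed.

Lemma sqsum_lt_l2 u (M : R) : (sqsum u <= M%:E)%E -> u \in @l2_pred R S.
Proof. by move=> uM; apply/asboolP; rewrite (le_lt_trans uM) ?ltry. Qed.

Lemma l2norm_le_sqsum f (M : R) : 0 <= M -> (sqsum f <= (M ^+ 2)%:E)%E ->
  l2norm f <= M.
Proof.
move=> M0 fM; rewrite -(@ler_pXn2r _ 2) ?nnegrE ?l2norm_ge0//.
by rewrite sqr_l2norm -lee_fin fineK ?sqsum_fin.
Qed.

Lemma normc_le_l2norm f s : Normc.normc (f s) <= l2norm f.
Proof.
rewrite -(@ler_pXn2r _ 2) ?nnegrE ?l2norm_ge0 ?normc_ge0//.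
by have := @fsum_le_sqr_l2norm f [set s] (finite_set1 s); rewrite fsbig_set1.
Qed.

(** Coordinates converge because the real line is complete. Each finite partial sum
    of [|u p - u q|^2] passes to the limit in [q], so the coordinatewise limit is
    square summable and is also the limit in norm. The convergence is phrased with
    the members of the filter, because [l2norm] takes real values and is not the norm
    of a normed module structure. *)
Lemma l2_complete (P : Type) (F : set_system P) (u : P -> H) : ProperFilter F ->
  (forall eps : R, 0 < eps -> exists2 A, F A &
     forall p q, A p -> A q -> l2norm (u p - u q) <= eps) ->
  exists l : H, forall eps : R, 0 < eps -> exists2 A, F A &
     forall p, A p -> l2norm (u p - l) <= eps.
Proof.
move=> FF uF.
have cvg_coord (c : R[i] -> R) :
    (forall z w, c (z - w) = c z - c w) ->
    (forall z, `|c z| <= Normc.normc z) ->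
    forall s, exists x : R, c (u p s) @[p --> F] --> x.
  move=> cB cle s; apply/cvg_ex/cauchy_cvgP/cauchy_exP => eps e0.
  have e2 : 0 < eps / 2 by rewrite divr_gt0.
  have [A FA uA] := uF _ e2.
  have [p Ap] := filter_ex FA.
  exists (c (u p s)); apply: (@filterS _ F _ A) => // q Aq /=; rewrite -ball_normE/=.
  rewrite -cB (le_lt_trans (cle _))//.
  have -> : u p s - u q s = (u p - u q) s by [].
  rewrite (le_lt_trans (normc_le_l2norm _ _))// (le_lt_trans (uA _ _ Ap Aq))//.
  by rewrite ltr_pdivrMr// ltr_pMr// ltr1n.
have [x xP] : {x : S -> R & forall s, complex.Re (u p s) @[p --> F] --> x s}.
  apply: (@choice _ _ (fun s x => complex.Re (u p s) @[p --> F] --> x)) => s.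
  apply: cvg_coord; last exact: normRe_le_normc.
  by case=> ? ? [].
have [y yP] : {y : S -> R & forall s, complex.Im (u p s) @[p --> F] --> y s}.
  apply: (@choice _ _ (fun s y => complex.Im (u p s) @[p --> F] --> y)) => s.
  apply: cvg_coord; last exact: normIm_le_normc.
  by case=> ? ? [].
pose l s := (x s +i* y s)%C.
have lim_le (p : P) (A : set P) (eps : R) : F A -> 0 <= eps ->
    (forall q, A q -> l2norm (u p - u q) <= eps) ->
    (sqsum (fun s => (u p s - l s)%R) <= (eps ^+ 2)%:E)%E.
  move=> FA e0 upA; apply: sqsum_le_fsum => X finX; rewrite fsbig_finite//=.
  have cv : \sum_(s <- finmap.enum_fset (fset_set X)) Normc.normc ((u p - u q) s) ^+ 2 @[q --> F]
      --> \sum_(s <- finmap.enum_fset (fset_set X)) Normc.normc (u p s - l s) ^+ 2.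
    elim: (finmap.enum_fset _) => [|s r IH].
      by under eq_fun do rewrite big_nil; rewrite big_nil; exact: cvg_cst.
    under eq_fun do rewrite big_cons; rewrite big_cons; apply: cvgD IH.
    rewrite normc_sqrE.
    have -> : (fun q => Normc.normc ((u p - u q) s) ^+ 2) = (fun q =>
        (complex.Re (u p s) - complex.Re (u q s)) ^+ 2 +
        (complex.Im (u p s) - complex.Im (u q s)) ^+ 2).
      apply/funext => q; rewrite normc_sqrE.
      have -> : (u p - u q) s = u p s - u q s by [].
      by case: (u p s) (u q s) => ? ? [].
    have -> : complex.Re (u p s - l s) = complex.Re (u p s) - x s.
      by rewrite /l; case: (u p s).
    have -> : complex.Im (u p s - l s) = complex.Im (u p s) - y s.
      by rewrite /l; case: (u p s).
    apply: cvgD; rewrite expr2; under eq_fun do rewrite expr2.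
      by apply: cvgM; apply: cvgB (xP s); exact: cvg_cst.
    by apply: cvgM; apply: cvgB (yP s); exact: cvg_cst.
  rewrite -(cvg_lim _ cv)//; apply: limr_le; first exact: cvgP cv.
  apply: (@filterS _ F _ A) => // q Aq.
  rewrite -fsbig_finite// (le_trans (fsum_le_sqr_l2norm _ finX))//.
  by rewrite ler_pXn2r ?nnegrE ?l2norm_ge0 ?upA.
have [A0 FA0 uA0] := uF _ ltr01.
have [p0 Ap0] := filter_ex FA0.
have dl2 : (fun s => u p0 s - l s) \in @l2_pred R S.
  by apply/sqsum_lt_l2/(lim_le p0 A0 _ FA0 ler01) => q; exact: uA0.
exists (u p0 - L2 dl2) => eps e0; have [A FA uA] := uF _ e0.
exists A => // p Ap; apply: l2norm_le_sqsum (ltW e0) _.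
have := lim_le p A _ FA (ltW e0) (fun q => uA p q Ap).
congr (_ <= _)%E; congr sqsum; apply/funext => s.
have -> : (u p - (u p0 - L2 dl2)) s = u p s - (u p0 s - (u p0 s - l s)) by [].
by rewrite subKr.
Qed.
End Complete.

(** * Bounded operators with an adjoint *)

Section Operators.
Context {R : realType} {S : choiceType}.
Local Notation H := (@l2 R S).
Implicit Types (f h e : H) (k : R[i]) (M : R).

Definition adjoint_pair (T U : H -> H) : Prop :=
  forall f h, inner (T f) h = inner f (U h).

Definition op_bound (T : H -> H) M : Prop :=
  0 <= M /\ forall f, l2norm (T f) <= M * l2norm f.

Lemma inner_injr f h : (forall e, inner e f = inner e h) -> f = h.
Proof. by move=> fh; apply: inner_inj => e; rewrite innerC fh -innerC. Qed.

Lemma adjoint_pair_sym T U : adjoint_pair T U -> adjoint_pair U T.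
Proof. by move=> TU f h; rewrite innerC -TU -innerC. Qed.

(** Linearity comes for free from the existence of an adjoint, since the inner
    product is linear and separates vectors. *)
Lemma adjoint_pair_lin T U : adjoint_pair T U ->
  forall k f h, T (k *: f + h) = k *: T f + T h.
Proof. by move=> TU k f h; apply: inner_inj => e; rewrite inner_lin !TU inner_lin. Qed.

(** [|U h|^2 = <T (U h), h> <= M |U h| |h|]. *)
Lemma adjoint_pair_bound T U M : adjoint_pair T U -> op_bound T M -> op_bound U M.
Proof.
move=> TU [M0 TM]; split=> // h.
have [->|Uh0] := eqVneq (l2norm (U h)) 0; first by rewrite mulr_ge0 ?l2norm_ge0.
have Uhp : 0 < l2norm (U h) by rewrite lt_def Uh0 l2norm_ge0.
rewrite -(ler_pM2r Uhp) -expr2.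
have -> : l2norm (U h) ^+ 2 = Normc.normc (inner (T (U h)) h).
  by rewrite TU innerff normc_real ger0_norm ?sqr_ge0.
rewrite (le_trans (cauchy_schwarz _ _))// mulrAC ler_wpM2r ?l2norm_ge0//.
Qed.

Lemma adjoint_pair_comp T1 U1 T2 U2 : adjoint_pair T1 U1 -> adjoint_pair T2 U2 ->
  adjoint_pair (T1 \o T2) (U2 \o U1).
Proof. by move=> TU1 TU2 f h; rewrite /= TU1 TU2. Qed.

Lemma op_bound_comp T1 T2 M1 M2 : op_bound T1 M1 -> op_bound T2 M2 ->
  op_bound (T1 \o T2) (M1 * M2).
Proof.
move=> [M10 b1] [M20 b2]; split=> [|f /=]; first exact: mulr_ge0.
by rewrite (le_trans (b1 _))// -mulrA ler_wpM2l.
Qed.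

Lemma op_bound_lin k T1 T2 M1 M2 : op_bound T1 M1 -> op_bound T2 M2 ->
  op_bound (k *: T1 + T2) (Normc.normc k * M1 + M2).
Proof.
move=> [M10 b1] [M20 b2]; split=> [|f /=].
  by rewrite addr_ge0 ?mulr_ge0 ?normc_ge0.
have -> : (k *: T1 + T2) f = k *: T1 f + T2 f by [].
rewrite (le_trans (l2normD _ _))// mulrDl lerD// l2normZ -mulrA.
by rewrite ler_wpM2l ?normc_ge0.
Qed.

Lemma adjoint_pair_conj_lin k T1 T2 U1 U2 :
  adjoint_pair T1 U1 -> adjoint_pair T2 U2 ->
  adjoint_pair (k *: T1 + T2) (k^* *: U1 + U2).
Proof.
move=> TU1 TU2 f h.
have -> : (k *: T1 + T2) f = k *: T1 f + T2 f by [].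
have -> : (k^* *: U1 + U2) h = k^* *: U1 h + U2 h by [].
by rewrite inner_lin innerDr innerZr conjCK TU1 TU2.
Qed.

(** Every bounded operator has an adjoint, by Riesz representation. Making the
    adjoint part of the definition avoids that theorem, and nothing is lost: in a
    star-homomorphism into the bounded operators, every value comes with its adjoint. *)
Definition adjointable : {pred H -> H} :=
  fun T => `[< (exists U, adjoint_pair T U) /\ (exists M, op_bound T M) >].

Lemma adjointableI T U M : adjoint_pair T U -> op_bound T M -> T \in adjointable.
Proof. by move=> TU TM; apply/asboolP; split; [exists U|exists M]. Qed.

Lemma adjointable_submod_closed : submod_closed adjointable.
Proof.
split=> [|k T1 T2 /asboolP[[U1 TU1] [M1 b1]] /asboolP[[U2 TU2] [M2 b2]]].
  apply: (@adjointableI _ 0 0) => [f h|].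
    by rewrite inner0l innerC inner0l conjC0.
  by split=> // f; rewrite mul0r l2norm0.
apply: adjointableI; last exact: (op_bound_lin k b1 b2).
exact: (adjoint_pair_conj_lin k TU1 TU2).
Qed.

HB.instance Definition _ := GRing.isSubmodClosed.Build R[i] (H -> H) adjointable
  adjointable_submod_closed.

Record adjop := Adjop { adjop_fun :> H -> H; adjopP : adjop_fun \in adjointable }.

HB.instance Definition _ := [isSub for adjop_fun].
HB.instance Definition _ := gen_eqMixin adjop.
HB.instance Definition _ := gen_choiceMixin adjop.
HB.instance Definition _ := [SubChoice_isSubLmodule of adjop by <:].

Implicit Types (T U : adjop).

Lemma adjop_eq T U : (forall f, T f = U f) -> T = U.
Proof. by move=> TU; apply: val_inj; apply/funext. Qed.

Lemma adjop_subE T U f : (T - U) f = T f - U f.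
Proof. by []. Qed.

Lemma adjop_adjoint T : exists U : H -> H, adjoint_pair T U.
Proof. by have /asboolP[] := adjopP T. Qed.

Lemma adjop_bounded T : exists M, op_bound T M.
Proof. by have /asboolP[] := adjopP T. Qed.

Definition adjoint_fun T : H -> H := projT1 (cid (adjop_adjoint T)).

Lemma adjoint_funP T : adjoint_pair T (adjoint_fun T).
Proof. exact: projT2 (cid (adjop_adjoint T)). Qed.

Lemma adjoint_fun_in T : adjoint_fun T \in adjointable.
Proof.
have [M b] := adjop_bounded T.
apply: adjointableI (adjoint_pair_sym (adjoint_funP T)) _.
exact: adjoint_pair_bound (adjoint_funP T) b.
Qed.

Definition adjoint T : adjop := Adjop (adjoint_fun_in T).

Lemma adjointP T : adjoint_pair T (adjoint T).
Proof. exact: adjoint_funP. Qed.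

Lemma adjoint_unique T U : adjoint_pair T U -> adjoint T = U.
Proof.
by move=> TU; apply: adjop_eq => f; apply: inner_injr => e; rewrite -adjointP TU.
Qed.

Lemma compop_in T U : T \o U \in adjointable.
Proof.
have [[M b] [N c]] := (adjop_bounded T, adjop_bounded U).
exact: adjointableI (adjoint_pair_comp (adjointP T) (adjointP U)) (op_bound_comp b c).
Qed.

Definition compop T U : adjop := Adjop (compop_in T U).

Lemma compopE T U f : compop T U f = T (U f).
Proof. by []. Qed.

(** The least bound of [T]; the infimum is itself a bound, by [opnormP]. *)
Definition opnorm T : R := inf [set M | op_bound T M].

Let has_inf_bound T : has_inf [set M | op_bound T M].
Proof.
split; first by have [M b] := adjop_bounded T; exists M.
by exists 0 => M [].
Qed.

Lemma opnorm_le T M : op_bound T M -> opnorm T <= M.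
Proof. by move=> b; apply: ge_inf => //; case: (has_inf_bound T). Qed.

Lemma opnorm_ge0 T : 0 <= opnorm T.
Proof. by apply: lb_le_inf => [|M []//]; case: (has_inf_bound T). Qed.

Lemma opnormP T : op_bound T (opnorm T).
Proof.
split=> [|f]; first exact: opnorm_ge0.
have [/l2norm0_eq0 ->|f0] := eqVneq (l2norm f) 0.
  have [M [_ b]] := adjop_bounded T.
  by rewrite (le_trans (b 0))// l2norm0 !mulr0.
have fp : 0 < l2norm f by rewrite lt_def f0 l2norm_ge0.
rewrite -ler_pdivrMr//; apply: lb_le_inf; first by case: (has_inf_bound T).
by move=> M [_ b]; rewrite ler_pdivrMr.
Qed.

Lemma l2norm_op T f : l2norm (T f) <= opnorm T * l2norm f.
Proof. by have [] := opnormP T. Qed.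

Lemma opnormD T U : opnorm (T + U) <= opnorm T + opnorm U.
Proof.
apply: opnorm_le; split=> [|f]; first by rewrite addr_ge0 ?opnorm_ge0.
have -> : (T + U) f = T f + U f by [].
by rewrite (le_trans (l2normD _ _))// mulrDl lerD ?l2norm_op.
Qed.

Lemma opnorm0_eq0 T : opnorm T = 0 -> T = 0.
Proof.
move=> T0; apply: adjop_eq => f; apply: l2norm0_eq0; apply/eqP.
by rewrite eq_le l2norm_ge0 andbT (le_trans (l2norm_op _ _))// T0 mul0r.
Qed.

Lemma opnormZ_le k T : opnorm (k *: T) <= Normc.normc k * opnorm T.
Proof.
apply: opnorm_le; split=> [|f]; first by rewrite mulr_ge0 ?normc_ge0 ?opnorm_ge0.
have -> : (k *: T) f = k *: T f by [].
by rewrite l2normZ -mulrA ler_wpM2l ?normc_ge0 ?l2norm_op.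
Qed.

Lemma opnormZ k T : opnorm (k *: T) = Normc.normc k * opnorm T.
Proof.
apply/eqP; rewrite eq_le opnormZ_le/=.
have [->|k0] := eqVneq k 0; first by rewrite Normc.normc0 mul0r opnorm_ge0.
have kp : 0 < Normc.normc k.
  by rewrite lt_def normc_ge0 andbT; apply: contra_neq k0 => /Normc.eq0_normc.
rewrite -ler_pdivlMl// -Normc.normcV.
by rewrite -{1}[T]scale1r -(mulVf k0) -scalerA opnormZ_le.
Qed.

Lemma opnorm_adjoint_le T : opnorm (adjoint T) <= opnorm T.
Proof. exact/opnorm_le/(adjoint_pair_bound (adjointP T))/opnormP. Qed.

Lemma opnorm_comp T U : opnorm (compop T U) <= opnorm T * opnorm U.
Proof. exact/opnorm_le/op_bound_comp/opnormP/opnormP. Qed.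

(** The C*-identity comes from [|T f|^2 = <T^* T f, f>]. *)
Lemma opnorm_adjoint_comp T : opnorm (compop (adjoint T) T) = opnorm T ^+ 2.
Proof.
apply/eqP; rewrite eq_le; apply/andP; split.
  rewrite (le_trans (opnorm_comp _ _))// expr2.
  by rewrite ler_wpM2r ?opnorm_ge0 ?opnorm_adjoint_le.
set N := opnorm (compop _ _).
have N0 : 0 <= N by exact: opnorm_ge0.
rewrite -(sqr_sqrtr N0) ler_pXn2r ?nnegrE ?opnorm_ge0 ?sqrtr_ge0//.
apply: opnorm_le; split=> [|f]; first exact: sqrtr_ge0.
rewrite -(@ler_pXn2r _ 2) ?nnegrE ?mulr_ge0 ?sqrtr_ge0 ?l2norm_ge0//.
rewrite exprMn (sqr_sqrtr N0).
have -> : l2norm (T f) ^+ 2 = Normc.normc (inner (compop (adjoint T) T f) f).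
  rewrite compopE (adjoint_pair_sym (adjointP T)) innerff normc_real.
  by rewrite ger0_norm ?sqr_ge0.
rewrite (le_trans (cauchy_schwarz _ _))// expr2 mulrA.
by rewrite ler_wpM2r ?l2norm_ge0 ?l2norm_op.
Qed.

Let normC T : R[i] := (opnorm T)%:C%C.

Let normC_triangle T U : normC (T + U) <= normC T + normC U.
Proof. by rewrite /normC -realCD lecR opnormD. Qed.

Let normCZ k T : normC (k *: T) = `|k| * normC T.
Proof. by rewrite /normC opnormZ realCM. Qed.

Let normC_eq0 T : normC T = 0 -> T = 0.
Proof. by move=> [/opnorm0_eq0]. Qed.

HB.instance Definition _ :=
  Lmodule_isNormed.Build R[i] adjop normC_triangle normCZ normC_eq0.

Lemma adjop_normE T : `|T| = (opnorm T)%:C%C.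
Proof. by []. Qed.

End Operators.

(** * The C*-algebra of adjointable operators *)

Section OperatorAlgebra.
Context {R : realType} {S : choiceType}.
Local Notation H := (@l2 R S).
Implicit Types (f h e : H) (k : R[i]) (M : R) (T U V : @adjop R S).

(** A family of maps that is Cauchy uniformly on bounded sets converges uniformly on
    bounded sets. It is stated for arbitrary maps so that it applies both to a filter
    of operators and to the filter of their adjoints. *)
Lemma uniform_l2_complete (P : Type) (F : set_system P) (Phi : P -> H -> H) :
  ProperFilter F ->
  (forall eps : R, 0 < eps -> exists2 A, F A & forall p q, A p -> A q ->
     forall f, l2norm (Phi p f - Phi q f) <= eps * l2norm f) ->
  exists L : H -> H, forall eps : R, 0 < eps -> exists2 A, F A &
     forall p, A p -> forall f, l2norm (Phi p f - L f) <= eps * l2norm f.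
Proof.
move=> FF FPhi.
have lim f : exists l : H, forall eps : R, 0 < eps -> exists2 A, F A &
    forall p, A p -> l2norm (Phi p f - l) <= eps.
  apply: l2_complete => eps e0.
  (* The uniform bound d * |f| is at most eps for d = eps / (|f| + 1). *)
  have n0 : 0 < l2norm f + 1 by rewrite ltr_wpDl ?l2norm_ge0.
  have d0 : 0 < eps / (l2norm f + 1) by rewrite divr_gt0.
  have [A FA AP] := FPhi _ d0; exists A => // p q Ap Aq.
  rewrite (le_trans (AP _ _ Ap Aq f))// -mulrA ler_piMr ?(ltW e0)//.
  by rewrite mulrC ler_pdivrMr// mul1r lerDl.
have [L LP] := choice lim; exists L => eps e0.
have [A FA AP] := FPhi _ e0; exists A => // p Ap f; apply/ler_addgt0Pr => d d0.
have [B FB BP] := LP f _ d0.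
have [q [Aq Bq]] := filter_ex (filterI FA FB).
rewrite (_ : Phi p f - L f = (Phi p f - Phi q f) + (Phi q f - L f)).
  exact: le_trans (l2normD _ _) (lerD (AP _ _ Ap Aq f) (BP _ Bq)).
by rewrite addrA subrK.
Qed.

Lemma adjointB T U f : adjoint T f - adjoint U f = adjoint (T - U) f.
Proof.
apply: inner_injr => e.
by rewrite innerBr -!adjointP -innerBl.
Qed.

(** The operators and their adjoints have limits [L] and [L'] by
    [uniform_l2_complete]; that [L'] is the adjoint of [L] is an identity that passes
    to the limit, by the Cauchy-Schwarz inequality. *)
Lemma adjop_complete (F : set_system (@adjop R S)) :
  ProperFilter F -> cauchy F -> cvg F.
Proof.
move=> FF /cauchyP Fc.
have small (eps : R) : 0 < eps -> exists2 A, F A &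
    forall T U, A T -> A U -> opnorm (T - U) <= eps.
  move=> e0; have e2 : 0 < (eps / 2)%:C%C by rewrite ltcR divr_gt0.
  have [V FV] := Fc _ e2; exists (ball V (eps / 2)%:C%C) => // T U.
  rewrite -ball_normE/= distrC !adjop_normE !ltcR => TV UV.
  rewrite -[T](subrK V) -addrA (le_trans (opnormD _ _))//.
  by rewrite [leRHS]splitr lerD ?ltW.
have [L LP] : exists L : H -> H, forall eps : R, 0 < eps -> exists2 A, F A &
    forall T, A T -> forall f, l2norm (T f - L f) <= eps * l2norm f.
  apply: (@uniform_l2_complete _ F (fun T => T)) => eps e0.
  have [A FA AP] := small _ e0; exists A => // T U TA UA f.
  rewrite -adjop_subE (le_trans (l2norm_op _ _))//.
  by rewrite ler_wpM2r ?l2norm_ge0 ?AP.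
have [L' LP'] : exists L : H -> H, forall eps : R, 0 < eps -> exists2 A, F A &
    forall T, A T -> forall f, l2norm (adjoint T f - L f) <= eps * l2norm f.
  apply: (@uniform_l2_complete _ F (fun T => adjoint T)) => eps e0.
  have [A FA AP] := small _ e0; exists A => // T U TA UA f.
  rewrite adjointB (le_trans (l2norm_op _ _))// ler_wpM2r ?l2norm_ge0//.
  by rewrite (le_trans (opnorm_adjoint_le _)) ?AP.
have LL' : adjoint_pair L L'.
  move=> f h; apply/eqP; rewrite -subr_eq0; apply/eqP/Normc.eq0_normc/eqP.
  rewrite eq_le normc_ge0 andbT; apply/ler_addgt0Pr => d d0; rewrite add0r.
  (* Two Cauchy-Schwarz errors are absorbed by c; adding 1 keeps c positive. *)
  pose c := 2 * (l2norm f * l2norm h) + 1.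
  have c0 : 0 < c by rewrite ltr_wpDl ?mulr_ge0 ?l2norm_ge0.
  have dc : 0 < d / c by rewrite divr_gt0.
  have [A FA AP] := LP _ dc; have [B FB BP] := LP' _ dc.
  have [T [TA TB]] := filter_ex (filterI FA FB).
  have -> : inner (L f) h - inner f (L' h) =
      inner f (adjoint T h - L' h) - inner (T f - L f) h.
    by rewrite innerBr innerBl -adjointP; ring.
  have -> (x y : R[i]) : x - y = x + (-1) * y by rewrite mulN1r.
  rewrite (le_trans (le_normcD _ _))// Normc.normcM.
  have -> : Normc.normc (-1 : R[i]) = 1.
    by rewrite /= oppr0 sqrrN expr1n expr0n addr0 sqrtr1.
  rewrite mul1r (le_trans (lerD (cauchy_schwarz _ _) (cauchy_schwarz _ _)))//.
  have := ler_wpM2r (l2norm_ge0 h) (AP _ TA f).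
  have := ler_wpM2l (l2norm_ge0 f) (BP _ TB h).
  set a := l2norm f * _; set b := _ * l2norm h => ha hb.
  rewrite (le_trans (lerD ha hb))//.
  have -> : l2norm f * (d / c * l2norm h) + d / c * l2norm f * l2norm h =
     d * ((c - 1) / c) by rewrite /c; ring.
  by rewrite ler_piMr ?(ltW d0)// ler_pdivrMr// mul1r lerBlDr lerDl.
have [A1 FA1 AP1] := LP _ ltr01; have [T1 TA1] := filter_ex FA1.
have Lb : op_bound L (opnorm T1 + 1).
  split=> [|f]; first by rewrite addr_ge0 ?opnorm_ge0.
  rewrite (_ : L f = T1 f - (T1 f - L f)); last by rewrite subKr.
  rewrite mulrDl.
  exact: le_trans (l2normB _ _) (lerD (l2norm_op T1 f) (AP1 _ TA1 f)).
apply/cvg_ex; exists (Adjop (adjointableI LL' Lb)); apply/cvgrPdist_le => eps.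
case: eps => x y; rewrite ltcE/= => /andP[/eqP-> x0].
have [A FA AP] := LP _ x0; apply: (@filterS _ F _ A) => // T TA.
rewrite distrC adjop_normE lecR; apply: opnorm_le; split=> [|f]; first exact: ltW.
exact: AP.
Qed.

HB.instance Definition _ := Uniform_isComplete.Build (@adjop R S) adjop_complete.

Let compA : associative (@compop R S).
Proof. by move=> T U V; exact: adjop_eq. Qed.

Let compDl T U V : compop (T + U) V = compop T V + compop U V.
Proof. exact: adjop_eq. Qed.

Let compDr T U V : compop T (U + V) = compop T U + compop T V.
Proof.
apply: adjop_eq => f; apply: inner_inj => e.
have -> : (compop T U + compop T V) f = T (U f) + T (V f) by [].
have -> : compop T (U + V) f = T (U f + V f) by [].
by rewrite adjointP !innerDl !adjointP.
Qed.

Let compZl k T U : compop (k *: T) U = k *: compop T U.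
Proof. exact: adjop_eq. Qed.

Let compZr k T U : compop T (k *: U) = k *: compop T U.
Proof.
apply: adjop_eq => f; apply: inner_inj => e.
have -> : (k *: compop T U) f = k *: T (U f) by [].
have -> : compop T (k *: U) f = T (k *: U f) by [].
by rewrite (adjointP T) !innerZl (adjointP T).
Qed.

Let adjointK : involutive (@adjoint R S).
Proof. by move=> T; apply: adjoint_unique; exact/adjoint_pair_sym/adjointP. Qed.

Let adjointD T U : adjoint (T + U) = adjoint T + adjoint U.
Proof.
apply: adjoint_unique => f h.
have -> : (T + U) f = T f + U f by [].
have -> : (adjoint T + adjoint U) h = adjoint T h + adjoint U h by [].
by rewrite innerDl innerDr !adjointP.
Qed.

Let adjointZ k T : adjoint (k *: T) = k^* *: adjoint T.
Proof.
apply: adjoint_unique => f h.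
have -> : (k *: T) f = k *: T f by [].
have -> : (k^* *: adjoint T) h = k^* *: adjoint T h by [].
by rewrite innerZl innerZr conjCK adjointP.
Qed.

Let adjointM T U : adjoint (compop T U) = compop (adjoint U) (adjoint T).
Proof. by apply: adjoint_unique => f h; rewrite /= !adjointP. Qed.

Let norm_comp T U : `|compop T U| <= `|T| * `|U|.
Proof. by rewrite !adjop_normE -realCM lecR opnorm_comp. Qed.

Let norm_adjoint_comp T : `|compop (adjoint T) T| = `|T| ^+ 2.
Proof. by rewrite !adjop_normE opnorm_adjoint_comp realCM. Qed.

HB.instance Definition _ :=
  CompleteNormedModule_isCStarAlgebra.Build R (@adjop R S) compA compDl compDr
    compZl compZr adjointK adjointD adjointZ adjointM norm_comp norm_adjoint_comp.

End OperatorAlgebra.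

(** * Operators given by partial bijections of the basis *)

(** A partial bijection, given by its graph so that the inverse is the converse
    relation and no choice of images is needed in statements. *)
Record pbij (S : Type) := PBij {
  prel :> S -> S -> Prop;
  prel_fun : forall s t t', prel s t -> prel s t' -> t = t';
  prel_inj : forall s s' t, prel s t -> prel s' t -> s = s'
}.

Section Shifts.
Context {R : realType} {S : choiceType}.
Local Notation H := (@l2 R S).
Local Notation pbij := (pbij S).

Definition pbij_inv (E : pbij) : pbij :=
  @PBij S (fun s t => E t s) (fun s t t' => @prel_inj _ E t t' s)
    (fun s s' t => @prel_fun _ E t s s').

Definition pdom (E : pbij) : set S := [set s | exists t, E s t].

Definition pimg (E : pbij) (s : S) : option S :=
  if pselect (exists t, E s t) is left p then Some (projT1 (cid p)) else None.

Variant pimg_spec (E : pbij) (s : S) : option S -> Prop :=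
| PimgSome t of E s t : pimg_spec E s (Some t)
| PimgNone of ~ pdom E s : pimg_spec E s None.

Lemma pimgP (E : pbij) s : pimg_spec E s (pimg E s).
Proof.
rewrite /pimg; case: pselect => [p|np]; last exact: PimgNone.
exact: PimgSome (projT2 (cid p)).
Qed.

Definition pull (E : pbij) (f : S -> R[i]) : S -> R[i] :=
  fun s => oapp f 0 (pimg E s).

Lemma pullE (E : pbij) f s t : E s t -> pull E f s = f t.
Proof.
move=> Est; rewrite /pull; case: pimgP => [t' Est'|[]]; last by exists t.
by rewrite /= (prel_fun Est Est').
Qed.

Lemma pull0 (E : pbij) f s : ~ pdom E s -> pull E f s = 0.
Proof.
move=> nE; rewrite /pull; case: pimgP => [t Est|//].
by case: nE; exists t.
Qed.

(** Summation is invariant under a change of index along a partial bijection when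
    both families vanish where it is undefined. *)
Lemma esum_pbij (E : pbij) (u w : S -> R) :
  (forall s t, E s t -> u s = w t) ->
  (forall s, ~ pdom E s -> u s = 0) -> (forall t, ~ pdom (pbij_inv E) t -> w t = 0) ->
  (\esum_(s in [set: S]) (u s)%:E = \esum_(s in [set: S]) (w s)%:E)%E.
Proof.
move=> uw u0 w0.
have restr (v : S -> R) (D : set S) : (forall s, ~ D s -> v s = 0) ->
    (\esum_(s in [set: S]) (v s)%:E = \esum_(s in D) (v s)%:E)%E.
  move=> v0; rewrite [RHS]esum_mkcond; apply: eq_esum => s _.
  by case: ifPn => // /negP; rewrite inE => /v0 ->.
rewrite (restr _ (pdom E))// (restr _ (pdom (pbij_inv E)))//.
pose e s := odflt s (pimg E s).
have eE s t : E s t -> e s = t.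
  move=> Est; rewrite /e; case: pimgP => [t' Est'|[]]; last by exists t.
  by rewrite /= (prel_fun Est Est').
rewrite [RHS](@reindex_esum _ _ _ (pdom E) _ e).
  by apply: eq_esum => s [t Est]; rewrite (eE _ _ Est) (uw _ _ Est).
split=> [s [t Est]|s s' /set_mem[t Est] /set_mem[t' Est']|t [s Est]].
- by rewrite (eE _ _ Est); exists s.
- by rewrite (eE _ _ Est) (eE _ _ Est') => tt'; apply: prel_inj Est _; rewrite tt'.
- by exists s; [exists t|exact: eE].
Qed.

Lemma csum_pbij (E : pbij) (u w : S -> R[i]) :
  (forall s t, E s t -> u s = w t) ->
  (forall s, ~ pdom E s -> u s = 0) -> (forall t, ~ pdom (pbij_inv E) t -> w t = 0) ->
  csum u = csum w.
Proof.
move=> uw u0 w0; rewrite /csum /rsum; congr ((_ - _) +i* (_ - _))%C;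
  congr fine; apply: (@esum_pbij E);
  do ?[by move=> s t /uw ->|by move=> s /u0 ->; rewrite /= ?oppr0 maxxx
      |by move=> s /w0 ->; rewrite /= ?oppr0 maxxx].
Qed.

Lemma sqsum_pull (E : pbij) f : (sqsum (pull E f) <= sqsum f)%E.
Proof.
pose w t := Normc.normc (pull (pbij_inv E) (pull E f) t) ^+ 2.
rewrite /sqsum (@esum_pbij E _ w) /w.
- apply: le_esum => t _; rewrite lee_fin.
  have [[s Est]|nt] := pselect (pdom (pbij_inv E) t).
    by rewrite (pullE _ Est) (pullE _ (Est : E s t)).
  by rewrite pull0// Normc.normc0 expr0n sqr_ge0.
- by move=> s t Est; rewrite (pullE _ (Est : pbij_inv E t s)).
- by move=> s ns; rewrite pull0// Normc.normc0 expr0n.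
- by move=> s ns; rewrite pull0// Normc.normc0 expr0n.
Qed.

Lemma pull_l2 (E : pbij) (f : H) : pull E f \in @l2_pred R S.
Proof.
by apply/asboolP; rewrite (le_lt_trans (sqsum_pull E f))//; exact/asboolP/(l2P f).
Qed.

Definition transfer_fun (E : pbij) (f : H) : H := L2 (pull_l2 E f).

Lemma transfer_adjoint (E : pbij) : adjoint_pair (transfer_fun E) (transfer_fun (pbij_inv E)).
Proof.
move=> f h; apply: (@csum_pbij E) => /=.
- by move=> s t Est; rewrite (pullE _ Est) (pullE _ (Est : pbij_inv E t s)).
- by move=> s ns; rewrite pull0// mul0r.
- by move=> s ns; rewrite pull0// conjC0 mulr0.
Qed.

Lemma transfer_bound (E : pbij) : op_bound (transfer_fun E) 1.
Proof.
split=> // f; rewrite mul1r; apply: l2norm_le_sqsum; first exact: l2norm_ge0.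
by rewrite sqr_l2norm fineK ?sqsum_fin// sqsum_pull.
Qed.

(** The operator [f |-> f o E]. On the basis it is the inverse of [E]: it sends
    [delta t] to [delta s] when [E s t], see [transfer_delta]. *)
Definition transfer (E : pbij) : @adjop R S :=
  Adjop (adjointableI (transfer_adjoint E) (transfer_bound E)).

Lemma transferE (E : pbij) (f : H) s t : E s t -> transfer E f s = f t.
Proof. exact: pullE. Qed.

Lemma transfer0 (E : pbij) (f : H) s : ~ pdom E s -> transfer E f s = 0.
Proof. exact: pull0. Qed.

Lemma transfer_star (E : pbij) : (transfer E)^#* = transfer (pbij_inv E).
Proof. by apply: (@adjoint_unique _ _ _ (transfer (pbij_inv E))); exact: transfer_adjoint. Qed.

Lemma transfer_delta (E : pbij) s t : E s t -> transfer E (delta t) = delta s.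
Proof.
move=> Est; apply: l2_eq => s'.
have [[t' Est']|ns] := pselect (pdom E s').
  rewrite (transferE _ Est') /=; congr (_%:R); congr nat_of_bool.
  apply/eqP/eqP => [tt'|ss']; first by apply: prel_inj Est' _; rewrite tt'.
  by apply: prel_fun Est' _; rewrite ss'.
rewrite transfer0//= (negbTE (_ : s' != s))//.
by apply/eqP => ss; apply: ns; exists t; rewrite ss.
Qed.

Lemma transfer_delta0 (E : pbij) t : ~ pdom (pbij_inv E) t -> transfer E (delta t) = 0.
Proof.
move=> nt; apply: l2_eq => s.
have [[t' Est]|ns] := pselect (pdom E s); last by rewrite transfer0.
rewrite (transferE _ Est)/= (negbTE (_ : t' != t))//.
by apply/eqP => tt; apply: nt; exists s; rewrite -tt.
Qed.

Definition pid (D : set S) : pbij.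
Proof.
by exists (fun s t => s = t /\ D s) => [s t t' [<- _] [<- _]|s s' t [-> _] [-> _]].
Defined.

(** The projection onto the vectors supported in [D]. *)
Definition restr (D : set S) : @adjop R S := transfer (pid D).

Lemma restrE D (f : H) s : D s -> restr D f s = f s.
Proof. by move=> Ds; apply: transferE. Qed.

Lemma restr0 D (f : H) s : ~ D s -> restr D f s = 0.
Proof. by move=> Ds; apply: transfer0 => -[t []]. Qed.

Lemma restr_star D : (restr D)^#* = restr D.
Proof.
rewrite transfer_star; apply: adjop_eq => f; apply: l2_eq => s.
have [Ds|nDs] := pselect (D s); first by rewrite restrE// (@transferE _ _ _ s).
by rewrite restr0// transfer0// => -[t [ts]]; rewrite ts.
Qed.

Lemma restr_mul D D' : restr D ** restr D' = restr (D `&` D').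
Proof.
apply: adjop_eq => f; apply: l2_eq => s.
have -> : (restr D ** restr D') f = restr D (restr D' f) by [].
have [Ds|nDs] := pselect (D s); last by rewrite !restr0// => -[].
rewrite restrE//; have [D's|nD's] := pselect (D' s); first by rewrite !restrE.
by rewrite !restr0// => -[].
Qed.

Lemma restr_set0 : restr set0 = 0.
Proof. by apply: adjop_eq => f; apply: l2_eq => s; rewrite restr0. Qed.

Lemma restrU D D' : restr (D `|` D') = restr D + restr D' - restr (D `&` D').
Proof.
apply: adjop_eq => f; apply: l2_eq => s.
have -> : (restr D + restr D' - restr (D `&` D')) f s =
  restr D f s + restr D' f s - restr (D `&` D') f s by [].
have [Ds|nDs] := pselect (D s); have [D's|nD's] := pselect (D' s).
- by rewrite !restrE ?addrK//; left.
- rewrite (restrE _ Ds) (restr0 _ nD's) restrE; last by left.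
  by rewrite restr0 ?addr0 ?subr0// => -[].
- rewrite (restrE _ D's) (restr0 _ nDs) restrE; last by right.
  by rewrite restr0 ?add0r ?subr0// => -[].
- by rewrite !restr0 ?addr0 ?subr0// => -[].
Qed.

Lemma restrB D D' : D' `<=` D -> restr D - restr D' = restr (D `\` D').
Proof.
move=> D'D; apply: adjop_eq => f; apply: l2_eq => s.
have -> : (restr D - restr D') f s = restr D f s - restr D' f s by [].
have [D's|nD's] := pselect (D' s).
  rewrite (restrE _ D's) (restrE _ (D'D _ D's)) subrr restr0// => -[_].
  exact.
rewrite (restr0 _ nD's) subr0; have [Ds|nDs] := pselect (D s).
  by rewrite !restrE.
by rewrite !restr0// => -[].
Qed.

Lemma restr_proj D : is_projection (restr D).
Proof. by split; [exact: restr_star|rewrite restr_mul setIid]. Qed.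

Lemma restr_le D D' : D' `<=` D -> cle (restr D') (restr D).
Proof.
move=> D'D; exists (restr (D `\` D')); rewrite restrB// restr_star.
by rewrite restr_mul setIid.
Qed.

Lemma transfer_mul_star (E : pbij) : transfer E ** (transfer E)^#* = restr (pdom E).
Proof.
rewrite transfer_star; apply: adjop_eq => f; apply: l2_eq => s.
have -> : (transfer E ** transfer (pbij_inv E)) f = transfer E (transfer (pbij_inv E) f) by [].
have [Es|nEs] := pselect (pdom E s); last by rewrite transfer0// restr0.
by rewrite restrE//; have [t Est] := Es; rewrite (transferE _ Est) (@transferE _ _ _ s).
Qed.

Lemma transfer_star_mul (E : pbij) : (transfer E)^#* ** transfer E = restr (pdom (pbij_inv E)).
Proof.
by rewrite -[X in _ ** X]cstarK transfer_star transfer_mul_star.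
Qed.

Lemma transfer_pisom (E : pbij) : is_partial_isometry (transfer E).
Proof.
rewrite /is_partial_isometry transfer_mul_star; apply: adjop_eq => f.
apply: l2_eq => s.
have -> : (restr (pdom E) ** transfer E) f = restr (pdom E) (transfer E f) by [].
by have [Es|nEs] := pselect (pdom E s); [rewrite restrE|rewrite restr0// transfer0].
Qed.

End Shifts.

(** * Escape orbits of Markov maps *)

Section PartialMaps.
Context {R : realType} (g : R -> option R).

Lemma piterSr n y y' : g y = Some y' -> piter g n.+1 y = piter g n y'.
Proof. by rewrite /piter iterSr/= => ->. Qed.

Lemma piterS_defined n y w : piter g n.+1 y = Some w -> exists y', g y = Some y'.
Proof.
rewrite /piter iterSr/=; case: (g y) => [y' _|]; first by exists y'.
by have -> : iter n (obind g) None = None by elim: n => //= n ->.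
Qed.

End PartialMaps.

Section MarkovOrbits.
Context {R : realType} {a : R} {b : \bar R} {g : R -> option R}.
Context {lo hi : nat -> R} (hg : markov_class a b g lo hi).
Local Notation mI := (mI lo hi).
Local Notation mIo := (mIo lo hi).
Local Notation mdom := (mdom lo hi).
Local Notation endpoints := (endpoints lo hi).

Lemma mI_le n z : mI n z <-> lo n <= z <= hi n.
Proof. by rewrite /Defs.mI/= in_itv. Qed.

Lemma mIo_lt n z : mIo n z <-> lo n < z < hi n.
Proof. by rewrite /Defs.mIo/= in_itv. Qed.

Lemma mIo_mI n z : mIo n z -> mI n z.
Proof. by move=> /mIo_lt/andP[/ltW l /ltW h]; apply/mI_le/andP. Qed.

Lemma hi_le_lo i j : (i < j)%N -> hi i <= lo j.
Proof.
elim: j => // j IH; rewrite ltnS leq_eqVlt => /predU1P[->|/IH ij].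
  exact: markov_order hg j.
by rewrite (le_trans ij)// (le_trans (markov_le hg j))// (markov_order hg).
Qed.

(** An interior point of an interval lies in no other interval, since the intervals
    follow each other in order. *)
Lemma mIo_mI_inj i j z : mIo i z -> mI j z -> i = j.
Proof.
move=> /mIo_lt/andP[li hi_] /mI_le/andP[lj hj].
case: (ltngtP i j) => // /hi_le_lo ij.
- by have := lt_le_trans hi_ (le_trans ij lj); rewrite ltxx.
- by have := lt_le_trans li (le_trans hj ij); rewrite ltxx.
Qed.

Lemma endpointsNmIo i z : endpoints z -> ~ mIo i z.
Proof.
move=> [m zm] iz; have mz : mI m z.
  by apply/mI_le; case: zm => ->; rewrite lexx (markov_le hg).
move: (iz) => /mIo_lt; rewrite (mIo_mI_inj iz mz).
by case: zm => ->; rewrite ltxx ?andbF.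
Qed.

Lemma mI_mIo i z : mI i z -> ~ endpoints z -> mIo i z.
Proof.
move=> /mI_le/andP[l h] ne; apply/mIo_lt; rewrite !lt_neqAle l h !andbT.
by apply/andP; split; apply/eqP => e; apply: ne; exists i; [left|right].
Qed.

Lemma endpoints_piter n y w : endpoints y -> piter g n y = Some w -> endpoints w.
Proof.
move=> ye; elim: n w => [w [<-]//|n IH w]; rewrite /piter iterS -/(piter g n y).
case e: (piter g n y) => [v|//]/= gv; apply: (markov_endpoints hg).
by exists v => //; exact: IH.
Qed.

Lemma endpoints_mdom y : endpoints y -> mdom y.
Proof.
move=> [m ym]; exists m => //; apply/mI_le.
by case: ym => ->; rewrite lexx (markov_le hg).
Qed.

Lemma mdom_defined y : mdom y -> exists y', g y = Some y'.
Proof.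
rewrite -(markov_dom hg)/=; case: (g y) => [y' _|//]; by exists y'.
Qed.

Lemma defined_mdom y y' : g y = Some y' -> mdom y.
Proof. by move=> gy; rewrite -(markov_dom hg)/= gy. Qed.

Context {x : R} {tau : nat} {w : R}.
Context (xw : piter g tau x = Some w) (wout : ~ mdom w).
Local Notation orbit := (escape_orbit g lo hi x tau).

(** An endpoint never escapes, as endpoints are mapped to endpoints and lie in the
    domain. Hence the points of the escape orbit are interior to the interval that
    contains them, and that interval is unique; every use of the Markov property below
    relies on this. *)
Lemma orbitNendpoint y : orbit y -> ~ endpoints y.
Proof.
move=> [_ [n _ yn]] ye; apply: wout; apply: endpoints_mdom.
by apply: (@endpoints_piter n y) => //; rewrite yn.
Qed.

Lemma orbit_mIo i y : orbit y -> mI i y -> mIo i y.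
Proof. by move=> oy iy; apply: mI_mIo iy (orbitNendpoint oy). Qed.

Lemma orbit_preimage y z : orbit y -> g z = Some y -> orbit z.
Proof.
move=> [_ [n n0 yn]] gz; split; first exact: defined_mdom gz.
by exists n.+1 => //; rewrite (piterSr _ gz).
Qed.

Lemma orbit_image y z : orbit z -> g z = Some y -> mdom y -> orbit y.
Proof.
move=> [_ [[//|n] _ zn]] gz dy; split=> //.
move: zn; rewrite (piterSr _ gz); case: n => [|n] yn; last by exists n.+1.
by case: wout; move: yn; rewrite xw => -[<-].
Qed.

(** Along an escape orbit the map stays in the domain until it jumps to the common
    escape value [w]. *)
Lemma orbit_exit z : orbit z -> exists2 y, g z = Some y & mdom y \/ y = w.
Proof.
move=> [dz [[//|n] _ zn]]; have [y gz] := mdom_defined dz; exists y => //.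
move: zn; rewrite (piterSr _ gz) xw; case: n => [[->]|n]; first by right.
by move=> /piterS_defined[y' /defined_mdom]; left.
Qed.

(** The Markov condition concerns the closed intervals: the image of [mI i] contains
    all of [mI j] as soon as it contains an interior point of it. The inclusion of
    interiors follows because endpoints of [mI i] are mapped to endpoints. *)
Lemma range_of_image i j z y : orbit y -> mIo i z -> g z = Some y -> mI j y ->
  mIo j `<=` pimage g (mIo i).
Proof.
move=> oy iz gz jy u ju.
have [K _ iK] := markov_union hg i.
have : (\bigcup_(n in K) mI n) y.
  by rewrite -iK; split; [exists z => //; exact: mIo_mI|exists j].
move=> [n Kn ny]; have jn := mIo_mI_inj (orbit_mIo oy jy) ny.
have : (\bigcup_(n in K) mI n) u by exists n => //; rewrite -jn; exact: mIo_mI.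
rewrite -iK => -[[v iv gv] _]; exists v => //; apply: mI_mIo => // ve.
by apply: (endpointsNmIo _ ju); apply: (markov_endpoints hg); exists v.
Qed.

Lemma unique_preimage i y : orbit y ->
    vset lo hi (@range_of (markov_ultragraph g lo hi) i) y ->
  exists z, [/\ orbit z, mIo i z, g z = Some y
    & forall v, mI i v -> g v = Some y -> v = z].
Proof.
move=> oy [j /= ji jy]; have [z iz gz] := ji _ (orbit_mIo oy jy).
exists z; split=> //; first exact: orbit_preimage gz.
move=> v iv gv; apply: (markov_inj hg _ iz); last by rewrite gv.
exact: orbit_mIo (orbit_preimage oy gv) iv.
Qed.

Local Notation S := (set_type orbit).

Let orbitP (y : S) : orbit (val y). Proof. exact: set_mem (valP y). Qed.

Definition vdom (B : set nat) : set S := [set y | vset lo hi B (val y)].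

Lemma vdom0 : vdom set0 = set0.
Proof. by rewrite eqEsubset; split=> // y [j]. Qed.

Lemma vdomU V W : vdom (V `|` W) = vdom V `|` vdom W.
Proof. by rewrite /vdom /vset bigcup_setU. Qed.

Lemma vdomI V W : vdom (V `&` W) = vdom V `&` vdom W.
Proof.
rewrite eqEsubset; split=> [y [j [Vj Wj] jy]|y [[i Vi iy] [j Wj jy]]].
  by split; exists j.
have ij := mIo_mI_inj (orbit_mIo (orbitP y) iy) jy.
by exists i => //; split=> //; rewrite ij.
Qed.

(** The graph of the restriction of [g] to the [i]-th open interval and the escape
    orbit; [transfer] turns it into the operator attached to the edge [i]. *)
Definition branch (i : nat) : pbij S.
Proof.
exists (fun z y => [/\ mIo i (val z), g (val z) = Some (val y)
  & vdom (@range_of (markov_ultragraph g lo hi) i) y]).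
- by move=> s t t' [_ e _] [_ e' _]; apply: val_inj; move: e'; rewrite e => -[].
- move=> s s' t [is_ e _] [is' e' _]; apply: val_inj.
  by apply: (markov_inj hg is_ is'); rewrite e.
Defined.

Lemma pdom_branch_sub i : pdom (branch i) `<=` vdom [set i].
Proof. by move=> z [y [iz _ _]]; exists i => //; exact: mIo_mI. Qed.

Lemma pdom_branch_disj i j : i <> j -> pdom (branch i) `&` pdom (branch j) = set0.
Proof.
move=> ij; rewrite -subset0 => z [[y [iz _ _]] [y' [jz _ _]]].
by apply: ij; exact: mIo_mI_inj iz (mIo_mI jz).
Qed.

Lemma pdom_inv_branch i :
  pdom (pbij_inv (branch i)) = vdom (@range_of (markov_ultragraph g lo hi) i).
Proof.
rewrite eqEsubset; split=> [y [z []]//|y ry].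
have [z [oz iz gz _]] := unique_preimage (orbitP y) ry.
by exists (exist _ z (mem_set oz)).
Qed.

(** A point of the escape orbit in the [i]-th interval fails to be in the domain of
    the branch only if it jumps to [w] at once. This is the only place where the
    condition on the vertices of [X] enters. *)
Lemma pdom_branch i : (forall z, mIo i z -> g z <> Some w) ->
  pdom (branch i) = vdom [set i].
Proof.
move=> iw; rewrite eqEsubset; split; first exact: pdom_branch_sub.
move=> z [_ /= -> iz]; have oz := orbitP z; have {}iz := orbit_mIo oz iz.
have [y gz [dy|yw]] := orbit_exit oz; last by case: (iw _ iz); rewrite gz yw.
have oy := orbit_image oz gz dy.
exists (exist _ y (mem_set oy)); split=> //.
have [j _ jy] := dy; exists j => //=; exact: range_of_image iz gz jy.
Qed.

End MarkovOrbits.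

(** * Star-homomorphisms into the bounded operators *)

Section BoundedOperators.
Context {R : realType} {S : choiceType}.

Lemma bop_eq (T U : @bop R S) : (forall f, T f = U f) -> T = U.
Proof.
case: T U => [T Tl Tb] [U Ul Ub]/= /funext TU; case: _ / TU in Ul Ub *.
by congr Bop; exact: Prop_irrelevance.
Qed.

Lemma adjop_linear (T : @adjop R S) (k : R[i]) f h : T (k *: f + h) = k *: T f + T h.
Proof. exact: adjoint_pair_lin (adjointP T) k f h. Qed.

Lemma adjop_bop_bounded (T : @adjop R S) :
  exists M : R, forall f, l2norm (T f) <= M * l2norm f.
Proof. by have [M []] := adjop_bounded T; exists M. Qed.

Definition bop_of (T : @adjop R S) : @bop R S :=
  Bop (adjop_linear T) (adjop_bop_bounded T).

Lemma bop_op_bound (T : @bop R S) : exists M, op_bound T M.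
Proof.
have [M TM] := bop_bounded T; exists `|M|; split=> // f.
by rewrite (le_trans (TM f))// ler_wpM2r ?l2norm_ge0 ?ler_norm.
Qed.

Section Lift.
Context {A : cstarAlgType R} (nu : A -> @bop R S) (nuH : bop_star_hom nu).

Lemma bop_star_hom_adjointable x : bop_fun (nu x) \in @adjointable R S.
Proof.
have [_ _ nuS] := nuH; have [M b] := bop_op_bound (nu x).
exact: adjointableI (nuS x) b.
Qed.

(** A star-homomorphism into the bounded operators takes adjointable values, so it
    lifts to the C*-algebra of adjointable operators; this transports the uniqueness
    part of the universal property. *)
Definition lift_star_hom x : @adjop R S := Adjop (bop_star_hom_adjointable x).

Lemma lift_star_homP : star_hom lift_star_hom.
Proof.
have [nuL nuM nuS] := nuH; split=> [k x y|x y|x].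
- by apply: adjop_eq => f; exact: nuL.
- by apply: adjop_eq => f; exact: nuM.
- by apply/esym/(@adjoint_unique _ _ _ (lift_star_hom (x^#*))) => f h; exact: nuS.
Qed.

End Lift.

Lemma bop_of_star_hom (A : cstarAlgType R) (phi : A -> @adjop R S) :
  star_hom phi -> bop_star_hom (bop_of \o phi).
Proof.
move=> [phiL phiM phiS]; split=> [k x y f|x y f|x f h] /=.
- by rewrite phiL.
- by rewrite phiM.
- by rewrite phiS; exact: adjointP.
Qed.

End BoundedOperators.

Theorem proposition5p9 (R : realType) (a : R) (b : \bar R)
    (g : R -> option R) (lo hi : nat -> R)
    (hb : b != -oo%E) (hg : markov_class a b g lo hi)
    (x : R) (hx : escaping g lo hi x)
    (tau : nat) (htau : escape_time g lo hi x tau)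
    (J : nat) (hJ : exists2 z, piter g tau x = Some z & escape_set lo hi J z)
    (X : set nat)
    (hX : forall i, X i ->
       mIo lo hi i `&` ppreimage g 1 (escape_set lo hi J) = set0)
    (A : cstarAlgType R) (p : set nat -> A) (s : nat -> A)
    (hA : @is_ultragraph_algebra R (markov_ultragraph g lo hi) X A p s) :
  exists (W : set nat -> @bop R (set_type (escape_orbit g lo hi x tau)))
         (T : nat -> @bop R (set_type (escape_orbit g lo hi x tau))),
    [/\ forall B, @gen_vertices (markov_ultragraph g lo hi) B ->
          is_W B (W B),
        forall i, is_T i (T i)
      & exists! nu : A -> @bop R (set_type (escape_orbit g lo hi x tau)),
          [/\ bop_star_hom nu,
              forall B, @gen_vertices (markov_ultragraph g lo hi) B ->
                nu (p B) = W B
            & forall i, nu (s i) = T i]].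

Proof.
(* w is the point of the escape set J at which the orbit of x leaves the domain. *)
have [w xw Jw] := hJ.
have wout : ~ mdom lo hi w.
  have [_ [y [z [_ _ xz zout]]]] := htau.
  by move: xz; rewrite xw => -[->].
pose G := markov_ultragraph g lo hi.
pose dom (B : set nat) := vdom (g := g) (lo := lo) (hi := hi) (x := x) (tau := tau) B.
pose q B := restr (R := R) (dom B).
pose t i := transfer (R := R) (branch hg (x := x) (tau := tau) i).
have fam : @ultragraph_family R G X _ q t.
  split=> [V _|i|i j ij||V W _ _|V W _ _|i|i|i Xi].
  - exact: restr_proj.
  - exact: transfer_pisom.
  - by rewrite !transfer_mul_star restr_mul pdom_branch_disj ?restr_set0.
  - by rewrite /q /dom vdom0 restr_set0.
  - by rewrite /q /dom restr_mul (vdomI hg xw wout).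
  - by rewrite /q /dom vdomU restrU (vdomI hg xw wout).
  - by rewrite transfer_star_mul (pdom_inv_branch hg xw wout).
  - by rewrite transfer_mul_star; apply/restr_le/pdom_branch_sub.
  - rewrite (_ : [set e | source e = i] = [set i])// fsbig_set1 transfer_mul_star.
    rewrite (pdom_branch hg xw wout)// => z iz gz.
    suff : set0 z by [].
    by rewrite -(hX _ Xi); split=> //; exists w.
have [_ /(_ _ _ _ fam)[phi [[phiH phip phis] phiU]]] := hA.
exists (fun B => bop_of (q B)), (fun i => bop_of (t i)); split.
- move=> B _ y; split=> [By|nBy]; first exact: transfer_delta.
  by apply: transfer_delta0 => -[z [zy Bz]]; apply: nBy; rewrite -zy.
- move=> i y; split=> [ry|nry]; last first.
    by apply: transfer_delta0; rewrite (pdom_inv_branch hg xw wout).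
  have [z [oz iz gz zU]] := unique_preimage hg xw wout (set_mem (valP y)) ry.
  by exists (exist _ z (mem_set oz)); split=> //; exact: transfer_delta.
- exists (bop_of \o phi); split.
    split; first exact: bop_of_star_hom.
    + by move=> B gB; rewrite /= phip.
    + by move=> i; rewrite /= phis.
  move=> nu [nuH nup nus]; apply/funext => y; apply: bop_eq => f.
  have -> : phi = lift_star_hom nuH.
    apply: phiU; split; first exact: lift_star_homP.
    + by move=> B gB; apply: adjop_eq => h; rewrite /= nup.
    + by move=> i; apply: adjop_eq => h; rewrite /= nus.
  by [].
Qed.
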